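(* Let $T>0$ and consider the system $$u_t=\sigma(\theta,t)\Lambda v+g_1,\qquad v_t=-c(\theta,t)u+g_2,\qquad \theta\in\mathbb{T}=\mathbb{R}/2\pi\mathbb{Z},\ t\in[0,T],$$ where the coefficients $\sigma,c,g_1,g_2$ are real-valued and smooth, with $\sigma\ge\sigma_0>0$ and $c\ge c_0>0$ for constants $\sigma_0,c_0$. Let $r$ be a positive integer and let $\rho$ be a filter function satisfying the filter conditions of the context with this $r$. Suppose that the exact solution satisfies $(u,v)\in C^\infty(\mathbb{T}\times[0,T])$. Let $(U_e,V_e)(t)$ be the restriction of the exact solution to the grid $\theta_j=jh$, $h=2\pi/N$, $j=1,\dots,N$, and let $(U_h,V_h)$ be the numerical solution of the filtered pseudo-spectral semi-discretization $$\frac{dU_h}{dt}=\sigma\mathcal{L}_\rho V_h+g_1,\qquad \frac{dV_h}{dt}=-cU_h+g_2$$ (with $\sigma,c,g_1,g_2$ restricted to the grid points and products taken componentwise) with the same initial values. Then there exists a constant $M(T)>0$, independent of $h$, such that for all $t\in[0,T]$, $$\|U_h(t)-U_e(t)\|_2\le M(T)h^r,\qquad \|V_h(t)-V_e(t)\|_{H_h^{1/2}}\le M(T)h^r.$$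
   Context: $\Lambda=(-\Delta)^{1/2}$ is the operator on $\mathbb{T}$ with Fourier symbol $|k|$. $N$ is an even positive integer, $h=2\pi/N$, and $[N]^*=\{-\tfrac N2+1,\dots,\tfrac N2\}$. The discrete Fourier transform of an $N$-vector $f=(f_j)_{j=1}^N$ is $\hat f_k=\frac1N\sum_{j=1}^N f_je^{-ik\theta_j}$, $k\in[N]^*$, so that $f_j=\sum_{k\in[N]^*}\hat f_ke^{ik\theta_j}$. Filter conditions: $\rho:(-\pi,\pi]\to\mathbb{R}$ is nonnegative, even, and in $C^2(-\pi,\pi]$ (not necessarily $C^2$ when extended periodically), and $\sup_{\xi\in(0,\pi)}|\xi|^{-r}|\rho(\xi)-1|<\infty$. The operator $\mathcal{L}_\rho$ on $N$-vectors is defined by: $g=\mathcal{L}_\rho f$ means $\hat g_k=\rho(hk)|k|\hat f_k$ for $k\in[N]^*$. Norms: $\|f\|_2^2=\sum_{j=1}^N h|f_j|^2$ and $\|f\|_{H_h^{1/2}}^2=\sum_{k\in[N]^*}(1+|k|\rho(kh))|\hat f_k|^2$. *)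

(* Defs.v *)
From Stdlib Require Import Reals ZArith.
From Coquelicot Require Import Coquelicot.
Open Scope R_scope.

(** * Smooth functions on the torus times a time interval

    A function on the torus is a [2 * PI]-periodic function on [R].  Functions of
    [(theta, t)] are total in [t], but only their values for [0 <= t <= T] matter. *)

(* Derivative along [D]: one-sided at the end points when [D] is an interval. *)
Definition is_derive_within {V : NormedModule R_AbsRing}
    (D : R -> Prop) (f : R -> V) (x : R) (l : V) : Prop :=
  filterdiff f (within D (locally x)) (fun y => scal y l).

(* [d a b] is the partial derivative of order [a] in [theta] and [b] in [t].  All of
   them exist and are jointly continuous up to the boundary of the time interval. *)
Definition smooth_upto {V : NormedModule R_AbsRing} (T : R) (f : R -> R -> V) : Prop :=
  exists d : nat -> nat -> R -> R -> V,
    (forall theta t, 0 <= t <= T -> d 0%nat 0%nat theta t = f theta t) /\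
    forall a b theta t, 0 <= t <= T ->
      is_derive (fun x => d a b x t) theta (d (S a) b theta t) /\
      is_derive_within (fun s => 0 <= s <= T) (fun s => d a b theta s) t
        (d a (S b) theta t) /\
      filterlim (fun p : R * R => d a b (fst p) (snd p))
        (within (fun p : R * R => 0 <= snd p <= T) (locally (theta, t)))
        (locally (d a b theta t)).

Definition smooth_torus {V : NormedModule R_AbsRing} (T : R) (f : R -> R -> V) : Prop :=
  (forall theta t, 0 <= t <= T -> f (theta + 2 * PI) t = f theta t) /\
  smooth_upto T f.

(** * Fourier series and the operator [Lambda] *)

(* exp (i x) *)
Definition expi (x : R) : C := (cos x, sin x).

Definition fourier (f : R -> C) (k : Z) : C :=
  (RtoC (/ (2 * PI)) *
   RInt (V := C_R_CompleteNormedModule)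
     (fun x => f x * expi (- (IZR k * x)))%C 0 (2 * PI))%C.

Definition Lambda_mode (f : R -> C) (theta : R) (k : Z) : C :=
  (RtoC (IZR (Z.abs k)) * fourier f k * expi (IZR k * theta))%C.

(* The sum over all [k] in [Z] of [Lambda_mode f theta k], pairing [n] with [-n];
   the mode [k = 0], which the pairing counts twice, vanishes. *)
Definition Lambda (f : R -> C) (theta : R) : C :=
  let a n := (Lambda_mode f theta (Z.of_nat n)
              + Lambda_mode f theta (- Z.of_nat n))%C in
  (Series (fun n => Re (a n)), Series (fun n => Im (a n))).

(** * Grid, discrete Fourier transform, filtered operator, discrete norms

    An [N]-vector is a function [nat -> C] of which only the values at [1, ..., N]
    matter. *)

Definition mesh (N : nat) : R := 2 * PI / INR N.

Definition grid (N j : nat) : R := INR j * mesh N.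

(* For [N] even, [freq N] maps [1, ..., N] onto the frequencies
   [- N / 2 + 1, ..., N / 2] in increasing order. *)
Definition freq (N i : nat) : Z := (Z.of_nat i - Z.of_nat (N / 2))%Z.

Definition dft (N : nat) (f : nat -> C) (k : Z) : C :=
  (RtoC (/ INR N) *
   sum_n_m (G := C_AbelianMonoid)
     (fun j => f j * expi (- (IZR k * grid N j)))%C 1 N)%C.

(* The vector whose discrete Fourier transform at each frequency [k] is
   [rho (h k) |k|] times that of [f], written by the inversion formula. *)
Definition filtered_Lambda (N : nat) (rho : R -> R) (f : nat -> C) (j : nat) : C :=
  sum_n_m (G := C_AbelianMonoid)
    (fun i => let k := freq N i in
       RtoC (rho (mesh N * IZR k) * IZR (Z.abs k))%R * dft N f k
       * expi (IZR k * grid N j))%C 1 N.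

Definition norm_l2 (N : nat) (f : nat -> C) : R :=
  sqrt (sum_n_m (fun j => mesh N * Cmod (f j) ^ 2) 1 N).

Definition norm_Hhalf (N : nat) (rho : R -> R) (f : nat -> C) : R :=
  sqrt (sum_n_m
    (fun i => let k := freq N i in
       (1 + IZR (Z.abs k) * rho (IZR k * mesh N)) * Cmod (dft N f k) ^ 2) 1 N).

(** * Filter functions *)

(* Only the values of [rho] on [(-PI, PI]] matter. *)
Definition filter_dom (xi : R) : Prop := - PI < xi <= PI.

Record filter_function (r : nat) (rho : R -> R) : Prop := {
  filter_nonneg : forall xi, filter_dom xi -> 0 <= rho xi;
  filter_even : forall xi, - PI < xi < PI -> rho (- xi) = rho xi;
  filter_C2 : exists rho1 rho2 : R -> R, forall xi, filter_dom xi ->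
    is_derive_within filter_dom rho xi (rho1 xi) /\
    is_derive_within filter_dom rho1 xi (rho2 xi) /\
    filterlim rho2 (within filter_dom (locally xi)) (locally (rho2 xi));
  filter_order : exists K : R, forall xi, 0 < xi < PI ->
    / Rabs xi ^ r * Rabs (rho xi - 1) <= K
}.

(** * The continuous system and its semi-discretization *)

Definition exact_solution (T : R) (sigma c g1 g2 : R -> R -> R) (u v : R -> R -> C) :
    Prop :=
  forall theta t, 0 <= t <= T ->
    is_derive_within (V := C_R_NormedModule) (fun s => 0 <= s <= T)
      (fun s => u theta s) t
      (RtoC (sigma theta t) * Lambda (fun x => v x t) theta + RtoC (g1 theta t))%C /\
    is_derive_within (V := C_R_NormedModule) (fun s => 0 <= s <= T)
      (fun s => v theta s) t
      (- (RtoC (c theta t) * u theta t) + RtoC (g2 theta t))%C.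

Definition semidiscrete_solution (T : R) (sigma c g1 g2 : R -> R -> R)
    (rho : R -> R) (N : nat) (Uh Vh : R -> nat -> C) : Prop :=
  forall t j, 0 <= t <= T -> (1 <= j <= N)%nat ->
    is_derive_within (V := C_R_NormedModule) (fun s => 0 <= s <= T)
      (fun s => Uh s j) t
      (RtoC (sigma (grid N j) t) * filtered_Lambda N rho (Vh t) j
       + RtoC (g1 (grid N j) t))%C /\
    is_derive_within (V := C_R_NormedModule) (fun s => 0 <= s <= T)
      (fun s => Vh s j) t
      (- (RtoC (c (grid N j) t) * Uh t j) + RtoC (g2 (grid N j) t))%C.

Definition restrict (N : nat) (w : R -> R -> C) (t : R) (j : nat) : C := w (grid N j) t.

(* Main.v *)
(** The error [(p, q) = (U_h - U_e, V_h - V_e)] solves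
    [p' = sigma (L q + tau)], [q' = - c p], where [L] is the filtered operator and
    [tau] the consistency error of [L] on the exact [v].  In the energy
    [sum h (c / sigma) |p|^2 + sum h |q|^2 + <q, L q>] the weight [c / sigma] makes the
    contributions of [L q] cancel exactly, since [L] is self-adjoint with a nonnegative
    symbol; no commutator is left and Gronwall's inequality bounds the energy by [sup |tau|^2].

    For [tau = O(h^r)] one needs that [dft k - fourier k] is [O(h^r / |k|^3)] for
    [|k| <= N / 2].  The trapezoid rule gives [O((h |k|)^m)] for every [m], which suffices
    when [h k^2 <= 1]; when [h k^2 > 1] both coefficients are rapidly decreasing in [k],
    by forward differences for the discrete one and by letting [N] tend to infinity
    for the continuous one. *)

Require Import Defs.
From Stdlib Require Import Reals ZArith Lra Lia Psatz ClassicalEpsilon.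
From Coquelicot Require Import Coquelicot.
Open Scope R_scope.

(** * Derivatives within a set, Gronwall's inequality *)

(** The obstacle is uniformity up to the frequency [N / 2]: there h |k| is of order one, and a
    quadrature error (h |k|)^m gives no power of h however large m is, while [tau] must be small at
    every grid point, with the errors of all modes summed. The cube in h^r / |k|^3 pays for the sum:
    one power of |k| is the symbol, the other two make the series over the modes converge. The
    quadrature and decay estimates rest on Rolle's theorem and on differences along the grid, so
    neither the convergence of a Fourier series to its function nor an aliasing formula enters. The
    frequency [N / 2] has no partner [- N / 2]; like the modes beyond the grid, it is estimated by
    decay alone. The plain sum of |q|^2 belongs to the energy because the symbol vanishes at k = 0,
    so that <q, L q> alone does not control q; by Parseval the two together control the H^{1/2}
    norm. All constants come from suprema over one period and the time interval, hence depend on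
    neither t nor N. *)

Lemma within_proper (D : R -> Prop) (x : R) :
  D x -> ProperFilter (within D (locally x)).
Proof.
  intros Dx; split; [|apply within_filter, locally_filter].
  intros P HP. exists x. apply (locally_singleton x _ HP), Dx.
Qed.

Lemma within_is_filter_lim (D : R -> Prop) (x : R) :
  is_filter_lim (within D (locally x)) x.
Proof.
  intros P HP. unfold within. apply (filter_imp P); [auto|exact HP].
Qed.

Section DeriveWithin.

Variables (D : R -> Prop) (x : R).
Hypothesis Dx : D x.

Let F_proper : ProperFilter (within D (locally x)) := within_proper D x Dx.

Lemma derive_within_ext (f g : R -> R) (l l' : R) :
  (forall y, D y -> f y = g y) -> l = l' ->
  is_derive_within D f x l -> is_derive_within D g x l'.
Proof.
  intros E <- H. unfold is_derive_within in *.
  apply (filterdiff_ext_loc f g); [| |exact H].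
  - unfold within. apply filter_forall. exact E.
  - intros y Hy.
    assert (y = x) as ->; [|apply E, Dx].
    exact (@is_filter_lim_unique _ R_NormedModule _ (Proper_StrongProper _ F_proper) y x
      Hy (within_is_filter_lim D x)).
Qed.

Lemma is_derive_derive_within (f : R -> R) (l : R) :
  is_derive f x l -> is_derive_within D f x l.
Proof.
  apply (@filterdiff_locally _ _ _ _ F_proper f x _ (within_is_filter_lim D x)).
Qed.

Lemma derive_within_const (a : R) : is_derive_within D (fun _ => a) x 0.
Proof.
  unfold is_derive_within.
  apply (filterdiff_ext_lin _ (fun _ => zero)).
  - apply filterdiff_const.
  - intros y. symmetry. apply (scal_zero_r (V := R_NormedModule)).
Qed.

Lemma derive_within_plus (f g : R -> R) (a b : R) :
  is_derive_within D f x a -> is_derive_within D g x b ->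
  is_derive_within D (fun y => f y + g y) x (a + b).
Proof.
  intros Hf Hg. unfold is_derive_within.
  eapply filterdiff_ext_lin.
  - apply (filterdiff_plus_fct (F := within D (locally x)) f g); [exact Hf|exact Hg].
  - intros y. simpl. symmetry. apply (scal_distr_l (V := R_NormedModule)).
Qed.

Lemma derive_within_mult (f g : R -> R) (a b : R) :
  is_derive_within D f x a -> is_derive_within D g x b ->
  is_derive_within D (fun y => f y * g y) x (a * g x + f x * b).
Proof.
  intros Hf Hg. unfold is_derive_within in *.
  assert (Cf := filterdiff_continuous_aux f (ex_intro _ _ Hf) x (within_is_filter_lim D x)).
  assert (Cg := filterdiff_continuous_aux g (ex_intro _ _ Hg) x (within_is_filter_lim D x)).
  eapply filterdiff_ext_lin.
  - apply (filterdiff_comp_2 (F := within D (locally x)) f g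
      (fun u v : R_NormedModule => mult u v : R_NormedModule) _ _
      (fun u v : R_NormedModule => plus (mult u (g x)) (mult (f x) v) : R_NormedModule) Hf Hg).
    apply (@filterdiff_mult R_AbsRing _ (filtermap_proper_filter _ _ _ _ F_proper) (f x, g x)).
    + intros P HP. apply (filterlim_pair f g Cf Cg).
      destruct HP as [e He].
      exists (fun u => ball (f x) e u) (fun v => ball (g x) e v).
      * apply locally_ball.
      * apply locally_ball.
      * intros u v Hu Hv. apply He. split; assumption.
    + intros n m. apply Rmult_comm.
  - intros y. simpl. unfold scal, plus, mult; simpl. unfold mult; simpl. ring.
Qed.

Lemma derive_within_comp (f g : R -> R) (a b : R) :
  is_derive_within D f x a -> is_derive g (f x) b ->
  is_derive_within D (fun y => g (f y)) x (a * b).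
Proof.
  intros Hf Hg. unfold is_derive_within in *.
  assert (Cf := filterdiff_continuous_aux f (ex_intro _ _ Hf) x (within_is_filter_lim D x)).
  eapply filterdiff_ext_lin.
  - apply (filterdiff_comp (F := within D (locally x)) f g _ (fun y => scal y b) Hf).
    apply (@filterdiff_locally _ _ _ _ (filtermap_proper_filter _ _ f _ F_proper) g (f x));
      [exact Cf|exact Hg].
  - intros y. simpl. unfold scal; simpl. unfold mult; simpl. ring.
Qed.

Lemma derive_within_fst (f : R -> C) (l : C) :
  is_derive_within (V := C_R_NormedModule) D f x l ->
  is_derive_within D (fun y => fst (f y)) x (fst l).
Proof.
  intros Hf. unfold is_derive_within in *.
  eapply filterdiff_ext_lin.
  - apply (filterdiff_comp (F := within D (locally x)) f
     (fun z : C_R_NormedModule => fst z : R_NormedModule) _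
       (fun z : C_R_NormedModule => fst z : R_NormedModule) Hf).
    apply filterdiff_linear. apply (is_linear_fst (U := R_NormedModule) (V := R_NormedModule)).
  - reflexivity.
Qed.

Lemma derive_within_snd (f : R -> C) (l : C) :
  is_derive_within (V := C_R_NormedModule) D f x l ->
  is_derive_within D (fun y => snd (f y)) x (snd l).
Proof.
  intros Hf. unfold is_derive_within in *.
  eapply filterdiff_ext_lin.
  - apply (filterdiff_comp (F := within D (locally x)) f
     (fun z : C_R_NormedModule => snd z : R_NormedModule) _
       (fun z : C_R_NormedModule => snd z : R_NormedModule) Hf).
    apply filterdiff_linear. apply (is_linear_snd (U := R_NormedModule) (V := R_NormedModule)).
  - reflexivity.
Qed.

Lemma derive_within_continuous (f : R -> R) (l : R) :
  is_derive_within D f x l -> filterlim f (within D (locally x)) (locally (f x)).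
Proof.
  intros Hf. unfold is_derive_within in Hf.
  apply (filterdiff_continuous_aux f (ex_intro _ _ Hf) x (within_is_filter_lim D x)).
Qed.

Lemma derive_within_interior (f : R -> R) (l : R) :
  locally x D -> is_derive_within D f x l -> is_derive f x l.
Proof.
  intros HD [Hl Hf]. split; [exact Hl|].
  intros y Hy e.
  assert (x = y) as <- by apply (is_filter_lim_locally_unique (V := R_NormedModule) x y Hy).
  specialize (Hf x (within_is_filter_lim D x) e).
  unfold within in Hf. generalize (filter_and _ _ HD Hf).
  apply filter_imp. intros z [Dz Hz]. exact (Hz Dz).
Qed.

End DeriveWithin.

(** The projection of the line onto the time interval. Composing with it turns continuity within the
    interval into two-sided continuity, the form in which [MVT_gen] and [uniform_continuity_2d] take
    it. *)
Definition clamp (T t : R) : R := Rmax 0 (Rmin t T).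

Lemma clamp_in (T t : R) : 0 <= T -> 0 <= clamp T t <= T.
Proof.
  intros HT. unfold clamp, Rmax, Rmin.
  destruct (Rle_dec t T); destruct (Rle_dec 0 _); lra.
Qed.

Lemma clamp_id (T t : R) : 0 <= t <= T -> clamp T t = t.
Proof.
  intros Ht. unfold clamp, Rmax, Rmin.
  destruct (Rle_dec t T); destruct (Rle_dec 0 _); lra.
Qed.

Lemma clamp_lipschitz (T s t : R) : 0 <= T -> Rabs (clamp T s - clamp T t) <= Rabs (s - t).
Proof.
  intros HT. unfold clamp, Rmax, Rmin, Rabs.
  destruct (Rle_dec s T); destruct (Rle_dec t T);
    repeat destruct (Rle_dec 0 _); repeat destruct (Rcase_abs _); lra.
Qed.

Lemma continuity_clamp (T : R) (f : R -> R) : 0 <= T ->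
  (forall t, 0 <= t <= T -> filterlim f (within (fun s => 0 <= s <= T) (locally t)) (locally (f t))) ->
  forall t, continuity_pt (fun s => f (clamp T s)) t.
Proof.
  intros HT Hf t. apply continuity_pt_filterlim.
  apply filterlim_comp with (G := within (fun s => 0 <= s <= T) (locally (clamp T t)));
    [|apply Hf, clamp_in, HT].
  intros P [e He]. exists e. intros s Hs. apply He; [|apply clamp_in, HT].
  unfold ball in *; simpl in *; unfold AbsRing_ball, minus, plus, opp, abs in *; simpl in *.
  eapply Rle_lt_trans; [apply clamp_lipschitz, HT|exact Hs].
Qed.

(** With the integrating factor, (E + d) exp (- K s) has a nonpositive derivative, so it stays below
    its initial value d. *)
Lemma gronwall_within (T K d : R) (E E' : R -> R) :
  0 <= T -> 0 <= d -> 0 <= K -> E 0 = 0 ->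
  (forall t, 0 <= t <= T -> is_derive_within (fun s => 0 <= s <= T) E t (E' t)) ->
  (forall t, 0 <= t <= T -> E' t <= K * (E t + d)) ->
  forall t, 0 <= t <= T -> E t <= d * exp (K * T).
Proof.
  intros HT Hd HK E0 HE HE' t Ht.
  set (G := fun s => (E s + d) * exp (- K * s)).
  set (G' := fun s => E' s * exp (- K * s) + (E s + d) * (exp (- K * s) * - K)).
  assert (HG : forall s, 0 <= s <= T -> is_derive_within (fun s => 0 <= s <= T) G s (G' s)).
  { intros s Hs. unfold G.
    eapply derive_within_ext; [exact Hs|reflexivity| |apply derive_within_mult; [exact Hs| | ]].
    2: { apply derive_within_plus; [apply HE, Hs|apply derive_within_const]. }
    2: { apply is_derive_derive_within with (l := exp (- K * s) * - K); [exact Hs|].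
         auto_derive; [exact I|ring]. }
    unfold G'. ring. }
  assert (HG' : forall s, 0 <= s <= T -> G' s <= 0).
  { intros s Hs. unfold G'. specialize (HE' s Hs). generalize (exp_pos (- K * s)); intros.
    replace (E' s * exp (- K * s) + (E s + d) * (exp (- K * s) * - K))
      with (- ((K * (E s + d) - E' s) * exp (- K * s))) by ring.
    assert (0 <= (K * (E s + d) - E' s) * exp (- K * s)) by (apply Rmult_le_pos; lra). lra. }
  (* The clamped function is continuous at the end points as well, and it coincides with [G] near
     every interior point, where the derivative within the interval is an ordinary one. *)
  destruct (MVT_gen (fun s => G (clamp T s)) 0 t G') as [c [Hc Hc']].
  - rewrite Rmin_left, Rmax_right by lra. intros s Hs.
    apply (is_derive_ext_loc G).
    + assert (He : 0 < Rmin s (T - s)) by (apply Rmin_glb_lt; lra).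
      exists (mkposreal _ He). intros y Hy.
      unfold ball in Hy; simpl in Hy; unfold AbsRing_ball, minus, plus, opp, abs in Hy; simpl in Hy.
      rewrite clamp_id; [reflexivity|].
      generalize (Rmin_l s (T - s)), (Rmin_r s (T - s)). apply Rabs_def2 in Hy. lra.
    + apply derive_within_interior with (D := fun s => 0 <= s <= T); [|apply HG; lra].
      assert (He : 0 < Rmin s (T - s)) by (apply Rmin_glb_lt; lra).
      exists (mkposreal _ He). intros y Hy.
      unfold ball in Hy; simpl in Hy; unfold AbsRing_ball, minus, plus, opp, abs in Hy; simpl in Hy.
      generalize (Rmin_l s (T - s)), (Rmin_r s (T - s)). apply Rabs_def2 in Hy. lra.
  - intros s _. apply (continuity_clamp T G HT). intros u Hu.
    apply (derive_within_continuous _ _ _ _ (HG u Hu)).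
  - rewrite Rmin_left, Rmax_right in Hc by lra.
    rewrite !clamp_id in Hc' by lra.
    assert (G t <= G 0).
    { specialize (HG' c ltac:(lra)). nra. }
    unfold G in H at 2. rewrite E0, Rmult_0_r, exp_0 in H.
    assert (E t + d <= d * exp (K * t)).
    { apply Rmult_le_reg_r with (exp (- K * t)); [apply exp_pos|].
      rewrite Rmult_assoc, <- exp_plus. replace (K * t + - K * t) with 0 by ring.
      rewrite exp_0. unfold G in H. lra. }
    assert (exp (K * t) <= exp (K * T)).
    { destruct (Req_dec (K * t) (K * T)) as [->|]; [lra|].
      apply Rlt_le, exp_increasing. nra. }
    nra.
Qed.

(** Uniform continuity on the compact rectangle gives a step length [d] over which [f] varies by
    less than 1. The segment from the origin to (x, t) is walked in [m] equal steps, with [m] the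
    same for all points, so |f| exceeds |f 0 0| by at most [m]. *)
Lemma strip_bounded (T L : R) (f : R -> R -> R) :
  0 <= T -> 0 <= L ->
  (forall x t, 0 <= t <= T ->
    filterlim (fun p : R * R => f (fst p) (snd p))
      (within (fun p : R * R => 0 <= snd p <= T) (locally (x, t))) (locally (f x t))) ->
  exists K, forall x t, 0 <= x <= L -> 0 <= t <= T -> Rabs (f x t) <= K.
Proof.
  intros HT HL Hf.
  destruct (uniform_continuity_2d (fun x t => f x (clamp T t)) 0 L 0 T) with (eps := mkposreal 1 Rlt_0_1)
    as [d Hd].
  { intros x t _ _ eps.
    destruct (Hf x (clamp T t) (clamp_in T t HT) (ball (f x (clamp T t)) eps) (locally_ball _ eps))
      as [e He].
    exists e. intros y s Hy Hs.
    apply (He (y, clamp T s)).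
    - split; [exact Hy|].
      unfold ball; simpl; unfold AbsRing_ball, minus, plus, opp, abs; simpl.
      eapply Rle_lt_trans; [apply clamp_lipschitz, HT|exact Hs].
    - apply clamp_in, HT. }
  destruct (nfloor_ex ((L + T) / d)) as [n [_ Hn]].
  { apply Rmult_le_pos; [lra|apply Rlt_le, Rinv_0_lt_compat, cond_pos]. }
  assert (dpos := cond_pos d).
  (* [m] exceeds (L + T) / d, so both coordinates advance by less than [d] in each step. *)
  set (m := S n).
  assert (Hm : 0 < INR m) by (unfold m; rewrite S_INR; generalize (pos_INR n); lra).
  assert (Hm' : L + T < INR m * d).
  { unfold m. rewrite S_INR. apply Rmult_lt_reg_r with (/ d); [apply Rinv_0_lt_compat, dpos|].
    rewrite Rmult_assoc, Rinv_r, Rmult_1_r by lra. exact Hn. }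
  exists (Rabs (f 0 0) + INR m). intros x t Hx Ht.
  assert (Hi : forall i, (i <= m)%nat ->
     Rabs (f (INR i * (x / INR m)) (INR i * (t / INR m))) <= Rabs (f 0 0) + INR i).
  { assert (Hb : forall i a B, (i <= m)%nat -> 0 <= a <= B -> 0 <= INR i * (a / INR m) <= B).
    { intros i a B Hi Ha. apply le_INR in Hi.
      assert (0 <= a / INR m) by (apply Rmult_le_pos; [lra|apply Rlt_le, Rinv_0_lt_compat, Hm]).
      split; [apply Rmult_le_pos; [apply pos_INR|lra]|].
      apply Rle_trans with (INR m * (a / INR m)); [apply Rmult_le_compat_r; lra|].
      replace (INR m * (a / INR m)) with a by (field; lra). lra. }
    assert (Hc : forall a, 0 <= a -> a <= L + T -> Rabs (a / INR m) < d).
    { intros a Ha Ha'. rewrite Rabs_pos_eq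
        by (apply Rmult_le_pos; [lra|apply Rlt_le, Rinv_0_lt_compat, Hm]).
      apply Rmult_lt_reg_r with (INR m); [exact Hm|].
      replace (a / INR m * INR m) with a by (field; lra). lra. }
    induction i as [|i IH]; intros Hi.
    - simpl. rewrite !Rmult_0_l. lra.
    - assert (Hi' : (i <= m)%nat) by lia. specialize (IH Hi').
      assert (Hd' := Hd (INR i * (x / INR m)) (INR i * (t / INR m))
         (INR (S i) * (x / INR m)) (INR (S i) * (t / INR m))
         (Hb i x L Hi' Hx) (Hb i t T Hi' Ht) (Hb (S i) x L Hi Hx) (Hb (S i) t T Hi Ht)).
      rewrite !clamp_id in Hd' by (apply Hb; [lia|lra]).
      rewrite S_INR in *.
      replace ((INR i + 1) * (x / INR m) - INR i * (x / INR m)) with (x / INR m) in Hd' by ring.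
      replace ((INR i + 1) * (t / INR m) - INR i * (t / INR m)) with (t / INR m) in Hd' by ring.
      specialize (Hd' (Hc x ltac:(lra) ltac:(lra)) (Hc t ltac:(lra) ltac:(lra))).
      apply (Rle_lt_trans _ _ _ (Rabs_triang_inv _ _)) in Hd'. cbn [pos] in Hd'. lra. }
  specialize (Hi m (le_n _)).
  replace (INR m * (x / INR m)) with x in Hi by (field; lra).
  replace (INR m * (t / INR m)) with t in Hi by (field; lra).
  exact Hi.
Qed.

(** * The trapezoid rule for periodic functions *)

(** The sums of the problem with range and monoid fixed. They stay convertible to the original ones,
    so [change] and [reflexivity] pass between the two. *)
Definition rsum (f : nat -> R) (N : nat) : R := sum_n_m (G := R_AbelianMonoid) f 1 N.

Definition csum (f : nat -> C) (N : nat) : C := sum_n_m (G := C_AbelianMonoid) f 1 N.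

Lemma rsum_0 (f : nat -> R) : rsum f 0 = 0.
Proof. apply (sum_n_m_zero (G := R_AbelianMonoid)). lia. Qed.

Lemma rsum_S (f : nat -> R) (N : nat) : rsum f (S N) = rsum f N + f (S N).
Proof. apply (sum_n_Sm (G := R_AbelianMonoid)). lia. Qed.

Lemma rsum_ext (f g : nat -> R) (N : nat) :
  (forall j, (1 <= j <= N)%nat -> f j = g j) -> rsum f N = rsum g N.
Proof. apply (sum_n_m_ext_loc (G := R_AbelianMonoid)). Qed.

Lemma rsum_le (f g : nat -> R) (N : nat) :
  (forall j, (1 <= j <= N)%nat -> f j <= g j) -> rsum f N <= rsum g N.
Proof.
  induction N as [|N IH]; intros H.
  - rewrite !rsum_0. lra.
  - rewrite !rsum_S. apply Rplus_le_compat; [apply IH; intros; apply H; lia|apply H; lia].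
Qed.

Lemma rsum_const (a : R) (N : nat) : rsum (fun _ => a) N = INR N * a.
Proof.
  induction N as [|N IH]; [rewrite rsum_0; simpl; ring|].
  rewrite rsum_S, IH, S_INR. ring.
Qed.

Lemma rsum_Rabs (f : nat -> R) (N : nat) : Rabs (rsum f N) <= rsum (fun j => Rabs (f j)) N.
Proof.
  induction N as [|N IH].
  - rewrite !rsum_0, Rabs_R0. lra.
  - rewrite !rsum_S. eapply Rle_trans; [apply Rabs_triang|]. lra.
Qed.

Lemma rsum_plus (f g : nat -> R) (N : nat) :
  rsum (fun j => f j + g j) N = rsum f N + rsum g N.
Proof. apply (sum_n_m_plus (G := R_AbelianMonoid)). Qed.

Lemma rsum_scal (a : R) (f : nat -> R) (N : nat) :
  rsum (fun j => a * f j) N = a * rsum f N.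
Proof. apply (sum_n_m_mult_l (K := R_Ring)). Qed.

Lemma is_derive_rsum (f : nat -> R -> R) (f' : nat -> R) (x : R) (N : nat) :
  (forall j, (1 <= j <= N)%nat -> is_derive (f j) x (f' j)) ->
  is_derive (fun y => rsum (fun j => f j y) N) x (rsum f' N).
Proof.
  induction N as [|N IH]; intros H.
  - rewrite rsum_0. eapply is_derive_ext; [intros y; symmetry; apply rsum_0|].
    apply (is_derive_const 0).
  - rewrite rsum_S. eapply is_derive_ext; [intros y; symmetry; apply rsum_S|].
    apply (is_derive_plus (K := R_AbsRing) (V := R_NormedModule)); [apply IH; intros|]; apply H; lia.
Qed.

Lemma is_derive_shift (f : R -> R) (x a l : R) :
  is_derive f (x + a) l -> is_derive (fun y => f (y + a)) x l.
Proof.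
  intros H.
  evar_last.
  - apply (is_derive_comp f (fun y => y + a)); [exact H|].
    auto_derive; [exact I|reflexivity].
  - apply Rmult_1_l.
Qed.

(** A smooth function carried together with all its derivatives. Shifts, differences and grid
    averages of a tower are again towers, so no derivative ever has to be constructed from an
    existence statement. *)
Definition tower (D : nat -> R -> R) : Prop :=
  forall a x, is_derive (D a) x (D (S a) x).

Lemma tower_periodic (D : nat -> R -> R) (p : R) :
  tower D -> (forall x, D 0%nat (x + p) = D 0%nat x) ->
  forall a x, D a (x + p) = D a x.
Proof.
  intros HD H0. induction a as [|a IH]; [exact H0|]. intros x.
  assert (E : is_derive (D a) x (D (S a) (x + p))).
  { apply (is_derive_ext (fun y => D a (y + p))); [exact IH|].
    apply is_derive_shift, HD. }
  rewrite <- (is_derive_unique _ _ _ E). apply is_derive_unique, HD.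
Qed.

Lemma tower_mvt (D : nat -> R -> R) (a : nat) (C x y : R) :
  tower D -> (forall z, Rabs (D (S a) z) <= C) -> Rabs (D a y - D a x) <= C * Rabs (y - x).
Proof.
  intros HD HC. apply bounded_variation with (dh := D (S a)). intros t _. split; [apply HD|apply HC].
Qed.

(* A derivative of a periodic function vanishes somewhere in each period, by
   Rolle, so it is controlled by the next derivative. *)
Lemma periodic_tower_bound (F : nat -> R -> R) (h C : R) (m a : nat) :
  0 < h -> tower F -> (forall x, F 0%nat (x + h) = F 0%nat x) ->
  (forall x, Rabs (F (S (a + m)) x) <= C) ->
  forall x, Rabs (F (S a) x) <= h ^ m * C.
Proof.
  intros Hh HF HP. revert a. induction m as [|m IH]; intros a HC x.
  - rewrite Nat.add_0_r in HC. simpl. rewrite Rmult_1_l. apply HC.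
  - assert (H1 : forall z, Rabs (F (S (S a)) z) <= h ^ m * C).
    { apply (IH (S a)). intros z. replace (S a + m)%nat with (a + S m)%nat by lia. apply HC. }
    destruct (MVT_gen (F a) x (x + h) (F (S a))) as [c [Hc Ec]].
    + intros; apply HF.
    + intros z _. apply continuity_pt_filterlim. apply (ex_derive_continuous (F a)).
      exists (F (S a) z). apply HF.
    + rewrite Rmin_left, Rmax_right in Hc by lra.
      rewrite (tower_periodic F h HF HP), Rminus_diag in Ec.
      assert (E0 : F (S a) c = 0).
      { destruct (Rmult_integral _ _ (eq_sym Ec)); lra. }
      assert (H2 := tower_mvt F (S a) _ c x HF H1).
      rewrite E0, Rminus_0_r in H2.
      assert (Rabs (x - c) <= h) by (rewrite Rabs_left1; lra).
      apply Rle_trans with (1 := H2). simpl.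
      assert (0 <= h ^ m * C) by (apply Rle_trans with (2 := H1 x), Rabs_pos).
      nra.
Qed.

Lemma mesh_pos (N : nat) : (0 < N)%nat -> 0 < mesh N.
Proof.
  intros HN. unfold mesh. apply Rdiv_lt_0_compat; [generalize PI_RGT_0; lra|apply lt_0_INR, HN].
Qed.

Lemma mesh_INR (N : nat) : (0 < N)%nat -> INR N * mesh N = 2 * PI.
Proof. intros HN. unfold mesh. apply lt_0_INR in HN. field. lra. Qed.

(** The shift moves every node to the next one, so partial sums differ only by their end terms; over
    the full grid these agree, since [grid N N] is the period. *)
Lemma rsum_shift_periodic (f : R -> R) (N : nat) (x : R) :
  (0 < N)%nat -> (forall y, f (y + 2 * PI) = f y) ->
  rsum (fun j => f (x + mesh N + grid N j)) N = rsum (fun j => f (x + grid N j)) N.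
Proof.
  intros HN Hf.
  assert (H : forall n, rsum (fun j => f (x + mesh N + grid N j)) n + f (x + mesh N)
     = rsum (fun j => f (x + grid N j)) n + f (x + mesh N + grid N n)).
  { induction n as [|n IH].
    - rewrite !rsum_0. unfold grid. simpl. rewrite !Rmult_0_l, !Rplus_0_r. ring.
    - rewrite !rsum_S.
      replace (x + grid N (S n)) with (x + mesh N + grid N n)
        by (unfold grid; rewrite S_INR; ring).
      lra. }
  specialize (H N). unfold grid in H at 3. rewrite mesh_INR, Hf in H by exact HN. lra.
Qed.

(** The quadrature error is the derivative at 0 of a function of period h: the grid average of the
    shifted antiderivative of [D 0] minus its mean. Since averaging over the grid leaves the small
    period h, each of the m + 1 steps of [periodic_tower_bound] from order 1 to order m + 2 gains a
    factor h. *)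
Lemma trapezoid_real (D : nat -> R -> R) (B : R) (N m : nat) :
  (0 < N)%nat -> tower D -> (forall x, D 0%nat (x + 2 * PI) = D 0%nat x) ->
  (forall x, Rabs (D (S m) x) <= B) ->
  Rabs (/ INR N * rsum (fun j => D 0%nat (grid N j)) N
        - / (2 * PI) * RInt (D 0%nat) 0 (2 * PI)) <= mesh N ^ S m * B.
Proof.
  intros HN HD HP HB.
  assert (Ppos := PI_RGT_0). assert (Npos := lt_0_INR _ HN).
  assert (Hc : forall x, continuous (D 0%nat) x).
  { intros x. apply (ex_derive_continuous (D 0%nat)). exists (D 1%nat x). apply HD. }
  assert (HI : forall a b, ex_RInt (D 0%nat) a b).
  { intros a b. apply (ex_RInt_continuous (V := R_CompleteNormedModule)). intros; apply Hc. }
  set (mu := / (2 * PI) * RInt (D 0%nat) 0 (2 * PI)).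
  (* The tower starts one order lower, at the antiderivative, so [T (S a)] is [D a] apart from the
     mean subtracted at order 1. *)
  set (T := fun a x => match a with
    | 0%nat => RInt (D 0%nat) 0 x - mu * x
    | 1%nat => D 0%nat x - mu
    | S a => D a x end).
  assert (HT : tower T).
  { intros [|[|a]] x; unfold T.
    - apply (is_derive_minus (K := R_AbsRing) (V := R_NormedModule)).
      + apply (is_derive_RInt (V := R_NormedModule) (D 0%nat) _ 0); [|apply Hc].
        apply filter_forall. intros y. apply (RInt_correct (V := R_CompleteNormedModule)), HI.
      + evar_last; [apply (is_derive_scal (fun y => y)), is_derive_id|].
        apply Rmult_1_r.
    - evar_last; [apply (is_derive_minus (K := R_AbsRing) (V := R_NormedModule) (D 0%nat) (fun _ => mu));
        [apply HD|apply (is_derive_const (K := R_AbsRing) (V := R_NormedModule))]|].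
      apply Rminus_0_r.
    - apply HD. }
  assert (HTP : forall x, T 0%nat (x + 2 * PI) = T 0%nat x).
  { intros x.
    (* The increment over a period is constant because [D 0] is periodic; the choice of [mu] makes
       it vanish at 0. *)
    set (W := fun y => T 0%nat (y + 2 * PI) - T 0%nat y).
    assert (HW : forall y, is_derive W y 0).
    { intros y. evar_last.
      - apply (is_derive_minus (K := R_AbsRing) (V := R_NormedModule)
          (fun y => T 0%nat (y + 2 * PI)) (T 0%nat)); [apply is_derive_shift, HT|apply HT].
      - unfold T. rewrite HP. apply Rminus_diag. }
    destruct (MVT_gen W 0 x (fun _ => 0)) as [c [_ E]].
    - intros; apply HW.
    - intros y _. apply continuity_pt_filterlim. apply (ex_derive_continuous W).
      exists 0. apply HW.
    - assert (E0 : W 0 = 0).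
      { unfold W, T. rewrite Rplus_0_l.
        rewrite (RInt_point (V := R_CompleteNormedModule)).
        unfold mu, zero; simpl. field. lra. }
      unfold W in *. lra. }
  set (F := fun a x => / INR N * rsum (fun j => T a (x + grid N j)) N).
  assert (HF : tower F).
  { intros a x. unfold F. apply (is_derive_scal (fun y => rsum (fun j => T a (y + grid N j)) N)).
    apply is_derive_rsum. intros j _. apply is_derive_shift, HT. }
  assert (HFP : forall x, F 0%nat (x + mesh N) = F 0%nat x).
  { intros x. unfold F. f_equal. apply (rsum_shift_periodic (T 0%nat)); assumption. }
  assert (HFB : forall x, Rabs (F (S (0 + S m)) x) <= B).
  { intros x. unfold F, T. simpl (0 + S m)%nat. rewrite Rabs_mult, Rabs_pos_eq
      by (apply Rlt_le, Rinv_0_lt_compat, Npos).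
    apply Rmult_le_reg_l with (1 := Npos). rewrite <- Rmult_assoc, Rinv_r, Rmult_1_l by lra.
    rewrite <- rsum_const. eapply Rle_trans; [apply rsum_Rabs|].
    apply rsum_le. intros j _. apply HB. }
  assert (H := periodic_tower_bound F (mesh N) B (S m) 0 (mesh_pos N HN) HF HFP HFB 0).
  replace (/ INR N * rsum (fun j => D 0%nat (grid N j)) N - mu) with (F 1%nat 0); [exact H|].
  unfold F, T.
  rewrite (rsum_ext _ (fun j => D 0%nat (grid N j) + - mu))
    by (intros j _; rewrite Rplus_0_l; reflexivity).
  rewrite rsum_plus, rsum_const. field. lra.
Qed.

(** * Discrete and continuous Fourier coefficients *)

Lemma Cmod_le_abs (z : C) : Cmod z <= Rabs (fst z) + Rabs (snd z).
Proof.
  destruct z as [a b]. simpl. unfold Cmod. simpl fst. simpl snd.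
  assert (Ha := Rabs_pos a). assert (Hb := Rabs_pos b).
  apply Rsqr_incr_0_var; [|lra].
  rewrite Rsqr_sqrt by nra. rewrite <- (pow2_abs a), <- (pow2_abs b). unfold Rsqr. nra.
Qed.

Lemma fst_le_Cmod (z : C) : Rabs (fst z) <= Cmod z.
Proof. exact (re_le_Cmod z). Qed.

Lemma snd_le_Cmod (z : C) : Rabs (snd z) <= Cmod z.
Proof. apply Rle_trans with (2 := Rmax_Cmod z), Rmax_r. Qed.

Lemma Cmod_minus_le (a b : C) : Cmod (a - b) <= Cmod a + Cmod b.
Proof. unfold Cminus. rewrite <- (Cmod_opp b). apply Cmod_triangle. Qed.

Lemma csum_0 (f : nat -> C) : csum f 0 = 0%C.
Proof. apply (sum_n_m_zero (G := C_AbelianMonoid)). lia. Qed.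

Lemma csum_S (f : nat -> C) (N : nat) : csum f (S N) = (csum f N + f (S N))%C.
Proof. apply (sum_n_Sm (G := C_AbelianMonoid)). lia. Qed.

Lemma csum_ext (f g : nat -> C) (N : nat) :
  (forall j, (1 <= j <= N)%nat -> f j = g j) -> csum f N = csum g N.
Proof. apply (sum_n_m_ext_loc (G := C_AbelianMonoid)). Qed.

Lemma csum_plus (f g : nat -> C) (N : nat) :
  csum (fun j => f j + g j)%C N = (csum f N + csum g N)%C.
Proof. apply (sum_n_m_plus (G := C_AbelianMonoid)). Qed.

Lemma csum_scal (a : C) (f : nat -> C) (N : nat) :
  csum (fun j => a * f j)%C N = (a * csum f N)%C.
Proof. apply (sum_n_m_mult_l (K := C_Ring)). Qed.

Lemma csum_minus (f g : nat -> C) (N : nat) :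
  csum (fun j => f j - g j)%C N = (csum f N - csum g N)%C.
Proof.
  rewrite (csum_ext _ (fun j => f j + (- (1)) * g j)%C) by (intros; ring).
  rewrite csum_plus, csum_scal. ring.
Qed.

Lemma csum_swap (f : nat -> nat -> C) (M N : nat) :
  csum (fun i => csum (fun j => f i j) N) M = csum (fun j => csum (fun i => f i j) M) N.
Proof.
  induction M as [|M IH].
  - rewrite csum_0. rewrite (csum_ext _ (fun _ => 0 * 0)%C).
    + rewrite csum_scal. ring.
    + intros j _. rewrite csum_0. ring.
  - rewrite csum_S, IH, <- csum_plus. apply csum_ext. intros j _. now rewrite csum_S.
Qed.

Lemma csum_fst (f : nat -> C) (N : nat) : fst (csum f N) = rsum (fun j => fst (f j)) N.
Proof.
  induction N as [|N IH]; [now rewrite csum_0, rsum_0|].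
  rewrite csum_S, rsum_S, <- IH. reflexivity.
Qed.

Lemma csum_snd (f : nat -> C) (N : nat) : snd (csum f N) = rsum (fun j => snd (f j)) N.
Proof.
  induction N as [|N IH]; [now rewrite csum_0, rsum_0|].
  rewrite csum_S, rsum_S, <- IH. reflexivity.
Qed.

Lemma csum_RtoC (f : nat -> R) (N : nat) : csum (fun j => RtoC (f j)) N = RtoC (rsum f N).
Proof.
  induction N as [|N IH]; [now rewrite csum_0, rsum_0|].
  now rewrite csum_S, rsum_S, IH, RtoC_plus.
Qed.

Lemma csum_conj (f : nat -> C) (N : nat) : Cconj (csum f N) = csum (fun j => Cconj (f j)) N.
Proof.
  induction N as [|N IH].
  - rewrite !csum_0. unfold Cconj. simpl. now rewrite Ropp_0.
  - now rewrite !csum_S, Cplus_conj, IH.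
Qed.

Lemma Cmod_csum (f : nat -> C) (N : nat) : Cmod (csum f N) <= rsum (fun j => Cmod (f j)) N.
Proof.
  induction N as [|N IH].
  - rewrite csum_0, rsum_0, Cmod_0. lra.
  - rewrite csum_S, rsum_S. eapply Rle_trans; [apply Cmod_triangle|]. lra.
Qed.

(** * The complex exponential on the unit circle *)

Lemma expi_plus (x y : R) : expi (x + y) = (expi x * expi y)%C.
Proof. unfold expi, Cmult. simpl. rewrite cos_plus, sin_plus. f_equal. ring. Qed.

Lemma expi_0 : expi 0 = 1%C.
Proof. unfold expi. now rewrite cos_0, sin_0. Qed.

Lemma Cmod_expi (x : R) : Cmod (expi x) = 1.
Proof.
  unfold Cmod, expi. simpl fst. simpl snd.
  rewrite <- sqrt_1. f_equal. generalize (sin2_cos2 x). unfold Rsqr. simpl. lra.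
Qed.

Lemma Cconj_expi (x : R) : Cconj (expi x) = expi (- x).
Proof. unfold Cconj, expi. simpl. now rewrite cos_neg, sin_neg. Qed.

Lemma expi_periodic (k : Z) : expi (IZR k * (2 * PI)) = 1%C.
Proof.
  assert (H : forall n, expi (INR n * (2 * PI)) = 1%C).
  { induction n as [|n IH]; [simpl; rewrite Rmult_0_l; apply expi_0|].
    rewrite S_INR, Rmult_plus_distr_r, expi_plus, IH, Rmult_1_l.
    unfold expi. rewrite cos_2PI, sin_2PI. apply Cmult_1_l. }
  destruct (Z_le_dec 0 k).
  - rewrite <- (Z2Nat.id k), <- INR_IZR_INZ by lia. apply H.
  - replace (IZR k * (2 * PI)) with (- (INR (Z.to_nat (- k)) * (2 * PI))).
    + rewrite <- Cconj_expi, H. unfold Cconj, RtoC. simpl. now rewrite Ropp_0.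
    + rewrite INR_IZR_INZ, Z2Nat.id, opp_IZR by lia. ring.
Qed.

(** The modulus is 2 |sin (y / 2)|, and sin w >= w / 3 on [0, 2], an interval that contains y / 2
    because PI <= 4. The constant 1/3 is not optimal, but follows from a Taylor polynomial. *)
Lemma Cmod_expi_minus_1 (y : R) : Rabs y <= PI -> Rabs y / 3 <= Cmod (expi y - 1)%C.
Proof.
  intros Hy.
  assert (E : expi y = expi (Rabs y) \/ Cconj (expi y) = expi (Rabs y)).
  { unfold Rabs. destruct (Rcase_abs y); [right; apply Cconj_expi|left; reflexivity]. }
  assert (E' : Cmod (expi y - 1)%C = Cmod (expi (Rabs y) - 1)%C).
  { destruct E as [->| <-]; [reflexivity|].
    rewrite <- Cmod_conj, Cminus_conj. do 2 f_equal. unfold Cconj. simpl. now rewrite Ropp_0. }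
  rewrite E'. set (z := Rabs y) in *. assert (Hz : 0 <= z) by apply Rabs_pos.
  clearbody z. clear E E' y. assert (P4 := PI_4).
  set (w := z / 2). replace z with (w + w) by (unfold w; field).
  assert (Hw : 0 <= w <= 2) by (unfold w; lra).
  assert (Hw' : 0 <= w <= PI) by (unfold w; lra). clearbody w.
  assert (S1 : w / 3 <= sin w).
  (* The Taylor lower bound of degree 7; after division by w the claim is a cubic inequality in s =
     w^2 on [0, 4]. *)
  { destruct (SIN w) as [S _]; [lra|lra|]. unfold sin_lb, sin_approx, sin_term in S.
    simpl in S. unfold Rsqr in S.
    assert (E : w - w ^ 3 / 6 + w ^ 5 / 120 - w ^ 7 / 5040 <= sin w) by lra.
    assert (0 <= w * w <= 4) by nra.
    set (s := w * w) in *.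
    assert (0 <= w * (1 - s / 6 + s * s / 120 - s * s * s / 5040 - 1/3)).
    { apply Rmult_le_pos; [lra|]. nra. }
    unfold s in *. nra. }
  assert (E : (expi (w + w) - 1)%C = (RtoC (2 * sin w) * (- sin w, cos w)%R)%C).
  { unfold expi. rewrite cos_plus, sin_plus. generalize (sin2_cos2 w). unfold Rsqr. intros Q.
    unfold Cminus, Cplus, Copp, Cmult, RtoC; simpl. f_equal; [|ring]. nra. }
  rewrite E, Cmod_mult, Cmod_R.
  replace (Cmod (- sin w, cos w)) with 1.
  - rewrite Rabs_pos_eq by lra. lra.
  - unfold Cmod. simpl fst. simpl snd. rewrite <- sqrt_1. f_equal.
    generalize (sin2_cos2 w). unfold Rsqr. simpl. lra.
Qed.

(** Componentwise, because the mean value theorem behind the estimates holds for real functions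
    only. This is the source of the factors 2 in the bounds below. *)
Definition Ctower (D : nat -> R -> C) : Prop :=
  tower (fun a x => fst (D a x)) /\ tower (fun a x => snd (D a x)).

(** * Decay of the discrete coefficients *)

Lemma csum_shift_periodic (f : R -> C) (N : nat) (x : R) :
  (0 < N)%nat -> (forall y, f (y + 2 * PI) = f y) ->
  csum (fun j => f (x + mesh N + grid N j)) N = csum (fun j => f (x + grid N j)) N.
Proof.
  intros HN Hf. apply injective_projections; rewrite ?csum_fst, ?csum_snd.
  - apply (rsum_shift_periodic (fun y => fst (f y))); [exact HN|]. intros y. now rewrite Hf.
  - apply (rsum_shift_periodic (fun y => snd (f y))); [exact HN|]. intros y. now rewrite Hf.
Qed.

Lemma Cmod_dft (N : nat) (f : nat -> C) (k : Z) (B : R) :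
  (0 < N)%nat -> (forall j, Cmod (f j) <= B) -> Cmod (dft N f k) <= B.
Proof.
  intros HN HB. assert (Npos := lt_0_INR _ HN).
  unfold dft. rewrite Cmod_mult, Cmod_R, Rabs_pos_eq by (apply Rlt_le, Rinv_0_lt_compat, Npos).
  apply Rmult_le_reg_l with (1 := Npos). rewrite <- Rmult_assoc, Rinv_r, Rmult_1_l by lra.
  rewrite <- rsum_const. eapply Rle_trans; [apply Cmod_csum|]. apply rsum_le. intros j _.
  rewrite Cmod_mult, Cmod_expi, Rmult_1_r. apply HB.
Qed.

Lemma expi_mul_periodic (k : Z) (x : R) :
  expi (- (IZR k * (x + 2 * PI))) = expi (- (IZR k * x)).
Proof.
  replace (- (IZR k * (x + 2 * PI))) with (- (IZR k * x) + IZR (- k) * (2 * PI))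
    by (rewrite opp_IZR; ring).
  rewrite expi_plus, expi_periodic. ring.
Qed.

(** The whole summand f x exp (- i k x) is periodic, so its grid sum is invariant under the shift;
    only the phase of one mesh width remains. *)
Lemma dft_shift (f : R -> C) (N : nat) (k : Z) :
  (0 < N)%nat -> (forall y, f (y + 2 * PI) = f y) ->
  dft N (fun j => f (grid N j + mesh N)) k
    = (expi (IZR k * mesh N) * dft N (fun j => f (grid N j)) k)%C.
Proof.
  intros HN Hf.
  set (g := fun x => (f x * expi (- (IZR k * x)))%C).
  assert (Hg : forall y, g (y + 2 * PI) = g y).
  { intros y. unfold g. now rewrite Hf, expi_mul_periodic. }
  assert (E := csum_shift_periodic g N 0 HN Hg).
  unfold dft.
  change (RtoC (/ INR N) * csum (fun j => f (grid N j + mesh N)%R * expi (- (IZR k * grid N j))) N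
    = expi (IZR k * mesh N) * (RtoC (/ INR N) * csum (fun j => g (grid N j)) N))%C.
  rewrite (csum_ext (fun j => g (grid N j)) (fun j => g (0 + grid N j)))
    by (intros; now rewrite Rplus_0_l).
  rewrite <- E.
  rewrite (csum_ext _ (fun j => expi (IZR k * mesh N) * g (0 + mesh N + grid N j)%R)%C).
  - rewrite csum_scal. ring.
  - intros j _. unfold g.
    replace (- (IZR k * grid N j)) with (IZR k * mesh N + - (IZR k * (0 + mesh N + grid N j))) by ring.
    rewrite expi_plus. replace (grid N j + mesh N) with (0 + mesh N + grid N j) by ring. ring.
Qed.

Lemma dft_minus (N : nat) (f g : nat -> C) (k : Z) :
  dft N (fun j => f j - g j)%C k = (dft N f k - dft N g k)%C.
Proof.
  unfold dft.
  change (RtoC (/ INR N) * csum (fun j => (f j - g j) * expi (- (IZR k * grid N j))) N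
    = RtoC (/ INR N) * csum (fun j => f j * expi (- (IZR k * grid N j))) N
    - RtoC (/ INR N) * csum (fun j => g j * expi (- (IZR k * grid N j))) N)%C.
  rewrite (csum_ext _ (fun j => f j * expi (- (IZR k * grid N j)) - g j * expi (- (IZR k * grid N j)))%C)
    by (intros; ring).
  rewrite csum_minus. ring.
Qed.

(** Discrete integration by parts: a forward difference multiplies the coefficient by exp (i k h) -
    1, while it costs one derivative and gains a factor h in the sup bounds. *)
Lemma dft_difference (N : nat) (k : Z) (m : nat) (D : nat -> R -> C) (B : nat -> R) :
  (0 < N)%nat -> Ctower D -> (forall x, D 0%nat (x + 2 * PI) = D 0%nat x) ->
  (forall a x, Cmod (D a x) <= B a) ->
  Cmod (dft N (fun j => D 0%nat (grid N j)) k) * Cmod (expi (IZR k * mesh N) - 1)%C ^ m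
    <= (2 * mesh N) ^ m * B m.
Proof.
  intros HN. revert D B. induction m as [|m IH]; intros D B HD HP HB.
  - simpl. rewrite Rmult_1_r, Rmult_1_l. apply Cmod_dft; [exact HN|]. intros; apply HB.
  - assert (hpos := mesh_pos N HN).
    (* The induction hypothesis is applied to the forward difference of the whole tower; the 2 adds
       the mean value estimates of the real and imaginary parts. *)
    assert (H := IH (fun a x => D a (x + mesh N)%R - D a x)%C (fun a => 2 * mesh N * B (S a))).
    simpl in H.
    rewrite (dft_minus N (fun j => D 0%nat (grid N j + mesh N)) (fun j => D 0%nat (grid N j)) k) in H.
    rewrite (dft_shift (D 0%nat) N k HN HP) in H.
    replace (expi (IZR k * mesh N) * dft N (fun j => D 0%nat (grid N j)) k
        - dft N (fun j => D 0%nat (grid N j)) k)%C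
      with ((expi (IZR k * mesh N) - 1) * dft N (fun j => D 0%nat (grid N j)) k)%C in H by ring.
    rewrite Cmod_mult in H. simpl. rewrite (Rmult_comm (2 * mesh N)), Rmult_assoc.
    replace (Cmod (dft N (fun j => D 0%nat (grid N j)) k) *
      (Cmod (expi (IZR k * mesh N) - 1) * Cmod (expi (IZR k * mesh N) - 1) ^ m))
      with (Cmod (expi (IZR k * mesh N) - 1) * Cmod (dft N (fun j => D 0%nat (grid N j)) k) *
           Cmod (expi (IZR k * mesh N) - 1) ^ m) by ring.
    apply H; clear H.
    + destruct HD as [H1 H2]. split; intros a x; simpl.
      * apply (is_derive_minus (K := R_AbsRing) (V := R_NormedModule) (fun x => fst (D a (x + mesh N)%R))
          (fun x => fst (D a x))); [apply (is_derive_shift (fun x => fst (D a x)))|]; apply H1.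
      * apply (is_derive_minus (K := R_AbsRing) (V := R_NormedModule) (fun x => snd (D a (x + mesh N)%R))
          (fun x => snd (D a x))); [apply (is_derive_shift (fun x => snd (D a x)))|]; apply H2.
    + intros x. replace (x + 2 * PI + mesh N) with (x + mesh N + 2 * PI) by ring. now rewrite !HP.
    + intros a x. destruct HD as [H1 H2].
      eapply Rle_trans; [apply Cmod_le_abs|].
      assert (K1 := tower_mvt _ a (B (S a)) x (x + mesh N) H1
        (fun z => Rle_trans _ _ _ (fst_le_Cmod _) (HB (S a) z))).
      assert (K2 := tower_mvt _ a (B (S a)) x (x + mesh N) H2
        (fun z => Rle_trans _ _ _ (snd_le_Cmod _) (HB (S a) z))).
      simpl in K1, K2. replace (x + mesh N - x) with (mesh N) in K1, K2 by ring.
      rewrite (Rabs_pos_eq (mesh N)) in K1, K2 by lra.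
      simpl. unfold Rminus in K1, K2. lra.
Qed.

(** For h |k| <= PI the factor exp (i k h) - 1 is at least h |k| / 3 in modulus, so the powers of h
    in [dft_difference] cancel and leave 6 = 2 * 3 for each order. *)
Lemma dft_decay (N : nat) (k : Z) (m : nat) (D : nat -> R -> C) (B : nat -> R) :
  (0 < N)%nat -> Ctower D -> (forall x, D 0%nat (x + 2 * PI) = D 0%nat x) ->
  (forall a x, Cmod (D a x) <= B a) -> Rabs (IZR k) * mesh N <= PI ->
  Cmod (dft N (fun j => D 0%nat (grid N j)) k) * Rabs (IZR k) ^ m <= 6 ^ m * B m.
Proof.
  intros HN HD HP HB Hk. assert (hpos := mesh_pos N HN).
  assert (H := dft_difference N k m D B HN HD HP HB).
  assert (Ha : Rabs (IZR k * mesh N) = Rabs (IZR k) * mesh N)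
    by (rewrite Rabs_mult, (Rabs_pos_eq (mesh N)); lra).
  assert (H1 : Rabs (IZR k) * mesh N / 3 <= Cmod (expi (IZR k * mesh N) - 1)%C).
  { rewrite <- Ha. apply Cmod_expi_minus_1. rewrite Ha. exact Hk. }
  set (X := Cmod (dft N _ k)) in *. assert (HX : 0 <= X) by apply Cmod_ge_0.
  assert (Hp : 0 < (mesh N / 3) ^ m) by (apply pow_lt; lra).
  apply Rmult_le_reg_r with (1 := Hp).
  rewrite Rmult_assoc, <- Rpow_mult_distr.
  replace (6 ^ m * B m * (mesh N / 3) ^ m) with ((2 * mesh N) ^ m * B m).
  - eapply Rle_trans; [|exact H]. apply Rmult_le_compat_l; [exact HX|].
    apply pow_incr. split; [|lra].
    apply Rmult_le_pos; [apply Rabs_pos|lra].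
  - replace (6 ^ m * B m * (mesh N / 3) ^ m) with ((6 ^ m * (mesh N / 3) ^ m) * B m) by ring.
    rewrite <- Rpow_mult_distr. f_equal. f_equal. field.
Qed.

(** The derivative conjugated by the exponential: (D exp (- i k x))' = (D' - i k D) exp (- i k x).
    It acts on whole towers, so it can be iterated. *)
Definition twist (k : Z) (D : nat -> R -> C) (a : nat) (x : R) : C :=
  (D (S a) x - RtoC (IZR k) * (Ci * D a x))%C.

Lemma twist_tower (k : Z) (D : nat -> R -> C) : Ctower D -> Ctower (twist k D).
Proof.
  intros [H1 H2]. split; intros a x.
  - apply is_derive_ext with (fun y => fst (D (S a) y) + IZR k * snd (D a y)).
    { intros y. unfold twist, Ci, Cmult; simpl. ring. }
    evar_last.
    + apply (is_derive_plus (K := R_AbsRing) (V := R_NormedModule)); [apply H1|].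
      apply (is_derive_scal (fun y => snd (D a y))), H2.
    + unfold twist, Ci, Cmult, plus; simpl. ring.
  - apply is_derive_ext with (fun y => snd (D (S a) y) + - IZR k * fst (D a y)).
    { intros y. unfold twist, Ci, Cmult; simpl. ring. }
    evar_last.
    + apply (is_derive_plus (K := R_AbsRing) (V := R_NormedModule)); [apply H2|].
      apply (is_derive_scal (fun y => fst (D a y))), H1.
    + unfold twist, Ci, Cmult, plus; simpl. ring.
Qed.

(* The derivative of order [a] of [D 0 x * exp (- i k x)]. *)
Definition modulate (k : Z) (D : nat -> R -> C) (a : nat) (x : R) : C :=
  (Nat.iter a (twist k) D 0%nat x * expi (- (IZR k * x)))%C.

Lemma iter_twist_tower (k : Z) (D : nat -> R -> C) (a : nat) :
  Ctower D -> Ctower (Nat.iter a (twist k) D).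
Proof. intros HD. induction a as [|a IH]; [exact HD|apply twist_tower, IH]. Qed.

Lemma modulate_tower (k : Z) (D : nat -> R -> C) : Ctower D -> Ctower (modulate k D).
Proof.
  intros HD.
  assert (Hc : forall x, is_derive (fun y => cos (- (IZR k * y))) x (IZR k * sin (- (IZR k * x)))).
  { intros x. auto_derive; [exact I|ring]. }
  assert (Hs : forall x, is_derive (fun y => sin (- (IZR k * y))) x (- IZR k * cos (- (IZR k * x)))).
  { intros x. auto_derive; [exact I|ring]. }
  split; intros a x; destruct (iter_twist_tower k D a HD) as [H1 H2];
    unfold modulate; simpl Nat.iter; set (X := Nat.iter a (twist k) D) in *.
  - unfold expi, Cmult. simpl.
    evar_last.
    + apply (is_derive_minus (K := R_AbsRing) (V := R_NormedModule)).
      * apply (is_derive_mult (fun y => fst (X 0%nat y)) (fun y => cos (- (IZR k * y)))); [apply H1|apply Hc|].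
        intros; apply Rmult_comm.
      * apply (is_derive_mult (fun y => snd (X 0%nat y)) (fun y => sin (- (IZR k * y)))); [apply H2|apply Hs|].
        intros; apply Rmult_comm.
    + unfold minus, plus, opp, mult; simpl. unfold twist, Ci, Cmult; simpl. ring.
  - unfold expi, Cmult. simpl.
    evar_last.
    + apply (is_derive_plus (K := R_AbsRing) (V := R_NormedModule)).
      * apply (is_derive_mult (fun y => fst (X 0%nat y)) (fun y => sin (- (IZR k * y)))); [apply H1|apply Hs|].
        intros; apply Rmult_comm.
      * apply (is_derive_mult (fun y => snd (X 0%nat y)) (fun y => cos (- (IZR k * y)))); [apply H2|apply Hc|].
        intros; apply Rmult_comm.
    + unfold minus, plus, opp, mult; simpl. unfold twist, Ci, Cmult; simpl. ring.
Qed.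

(** Each [twist] contributes D', one order higher, and k D at the same order; monotonicity of [B]
    puts both under the higher bound, with the common factor 1 + |k|. *)
Lemma iter_twist_bound (k : Z) (D : nat -> R -> C) (B : nat -> R) (m : nat) :
  (forall a x, Cmod (D a x) <= B a) -> (forall a, B a <= B (S a)) ->
  forall a x, Cmod (Nat.iter m (twist k) D a x) <= (1 + Rabs (IZR k)) ^ m * B (a + m)%nat.
Proof.
  intros HB HM. assert (Hk := Rabs_pos (IZR k)).
  induction m as [|m IH]; intros a x.
  - simpl. rewrite Nat.add_0_r, Rmult_1_l. apply HB.
  - simpl Nat.iter. unfold twist at 1. eapply Rle_trans; [apply Cmod_minus_le|].
    rewrite !Cmod_mult, Cmod_R, Cmod_Ci, Rmult_1_l.
    assert (H1 := IH (S a) x). assert (H2 := IH a x).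
    replace (a + S m)%nat with (S (a + m)) by lia.
    replace (S a + m)%nat with (S (a + m)) in H1 by lia.
    assert (H3 : Cmod (Nat.iter m (twist k) D a x) <= (1 + Rabs (IZR k)) ^ m * B (S (a + m))).
    { apply Rle_trans with (1 := H2). apply Rmult_le_compat_l; [apply pow_le; lra|apply HM]. }
    simpl. nra.
Qed.

Lemma RInt_pair (f : R -> C) (a b : R) :
  ex_RInt (fun x => fst (f x)) a b -> ex_RInt (fun x => snd (f x)) a b ->
  RInt (V := C_R_CompleteNormedModule) f a b
    = (RInt (fun x => fst (f x)) a b, RInt (fun x => snd (f x)) a b).
Proof.
  intros H1 H2. apply is_RInt_unique.
  apply (is_RInt_fct_extend_pair (U := R_NormedModule) (V := R_NormedModule));
    apply (RInt_correct (V := R_CompleteNormedModule)); assumption.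
Qed.

Lemma tower_ex_RInt (D : nat -> R -> R) (n : nat) (a b : R) : tower D -> ex_RInt (D n) a b.
Proof.
  intros HD. apply (ex_RInt_continuous (V := R_CompleteNormedModule)). intros x _.
  apply (ex_derive_continuous (D n)). exists (D (S n) x). apply HD.
Qed.

(** The trapezoid rule for the real and imaginary parts of D exp (- i k x), whose derivative of
    order m + 1 costs (1 + |k|)^(m + 1). *)
Lemma dft_fourier (N : nat) (k : Z) (m : nat) (D : nat -> R -> C) (B : nat -> R) :
  (0 < N)%nat -> Ctower D -> (forall x, D 0%nat (x + 2 * PI) = D 0%nat x) ->
  (forall a x, Cmod (D a x) <= B a) -> (forall a, B a <= B (S a)) ->
  Cmod (dft N (fun j => D 0%nat (grid N j)) k - fourier (D 0%nat) k)%C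
    <= 2 * (mesh N * (1 + Rabs (IZR k))) ^ S m * B (S m).
Proof.
  intros HN HD HP HB HM.
  destruct (modulate_tower k D HD) as [H1 H2].
  assert (EP : forall x, modulate k D 0%nat (x + 2 * PI) = modulate k D 0%nat x).
  { intros x. unfold modulate. simpl. now rewrite HP, expi_mul_periodic. }
  assert (EB : forall x, Cmod (modulate k D (S m) x) <= (1 + Rabs (IZR k)) ^ S m * B (S m)).
  { intros x. unfold modulate. rewrite Cmod_mult, Cmod_expi, Rmult_1_r.
    apply (iter_twist_bound k D B (S m) HB HM 0). }
  assert (T1 := trapezoid_real _ _ N m HN H1 (fun x => f_equal fst (EP x))
    (fun x => Rle_trans _ _ _ (fst_le_Cmod _) (EB x))).
  assert (T2 := trapezoid_real _ _ N m HN H2 (fun x => f_equal snd (EP x))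
    (fun x => Rle_trans _ _ _ (snd_le_Cmod _) (EB x))).
  assert (E : (dft N (fun j => D 0%nat (grid N j)) k - fourier (D 0%nat) k)%C =
    ((/ INR N * rsum (fun j => fst (modulate k D 0 (grid N j))) N -
        / (2 * PI) * RInt (fun x => fst (modulate k D 0 x)) 0 (2 * PI)),
     (/ INR N * rsum (fun j => snd (modulate k D 0 (grid N j))) N -
        / (2 * PI) * RInt (fun x => snd (modulate k D 0 x)) 0 (2 * PI)))).
  { unfold dft, fourier.
    (* Both coefficients are means of the same function [modulate k D 0], one over the grid and one
       over the period. *)
    change (RtoC (/ INR N) * csum (fun j => modulate k D 0 (grid N j)) N
     - RtoC (/ (2 * PI)) * RInt (V := C_R_CompleteNormedModule) (modulate k D 0%nat) 0 (2 * PI) =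
      ((/ INR N * rsum (fun j => fst (modulate k D 0 (grid N j))) N -
        / (2 * PI) * RInt (fun x => fst (modulate k D 0 x)) 0 (2 * PI))%R,
     (/ INR N * rsum (fun j => snd (modulate k D 0 (grid N j))) N -
        / (2 * PI) * RInt (fun x => snd (modulate k D 0 x)) 0 (2 * PI))%R))%C.
    rewrite RInt_pair;
      [|exact (tower_ex_RInt _ 0 0 (2 * PI) H1)|exact (tower_ex_RInt _ 0 0 (2 * PI) H2)].
    rewrite <- csum_fst, <- csum_snd.
    destruct (csum (fun j => modulate k D 0 (grid N j)) N) as [a b].
    unfold Cminus, Cplus, Copp, Cmult, RtoC; simpl. f_equal; ring. }
  rewrite E. eapply Rle_trans; [apply Cmod_le_abs|]. simpl fst. simpl snd.
  rewrite Rpow_mult_distr.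
  assert (X := Rplus_le_compat _ _ _ _ T1 T2). eapply Rle_trans; [exact X|].
  apply Req_le. ring.
Qed.

(** The bound of [dft_decay] does not depend on [N], so it passes to the limit. As k is fixed, a
    quadrature error of order h is enough, and [dft_fourier] is used at its lowest order. *)
Lemma fourier_decay (k : Z) (m : nat) (D : nat -> R -> C) (B : nat -> R) :
  Ctower D -> (forall x, D 0%nat (x + 2 * PI) = D 0%nat x) ->
  (forall a x, Cmod (D a x) <= B a) -> (forall a, B a <= B (S a)) ->
  Cmod (fourier (D 0%nat) k) * Rabs (IZR k) ^ m <= 6 ^ m * B m.
Proof.
  intros HD HP HB HM. apply le_epsilon. intros eps Heps.
  assert (Ppos := PI_RGT_0). assert (Hk := Rabs_pos (IZR k)).
  assert (B1 : 0 <= B 1%nat) by (apply Rle_trans with (2 := HB 1%nat 0), Cmod_ge_0).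
  (* [Q] is the coefficient of h in the quadrature error, multiplied by |k|^m. The grid is then
     taken so fine that h |k| <= PI, as [dft_decay] asks, and h Q <= eps. *)
  set (Q := Rabs (IZR k) ^ m * (2 * (1 + Rabs (IZR k)) * B 1%nat)).
  assert (HQ : 0 <= Q).
  { unfold Q. apply Rmult_le_pos; [apply pow_le, Hk|]. nra. }
  destruct (nfloor_ex (2 * Rabs (IZR k) + 2 * PI * Q / eps)) as [n [_ Hn]].
  { apply Rplus_le_le_0_compat; [lra|]. apply Rmult_le_pos; [nra|apply Rlt_le, Rinv_0_lt_compat, Heps]. }
  assert (HN : (0 < S n)%nat) by lia. rewrite <- S_INR in Hn. set (N := S n) in *. clearbody N.
  assert (Npos := lt_0_INR _ HN). assert (hN := mesh_INR N HN).
  assert (hpos := mesh_pos N HN).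
  assert (Q' : 0 <= 2 * PI * Q / eps) by (apply Rmult_le_pos; [nra|apply Rlt_le, Rinv_0_lt_compat, Heps]).
  assert (H1 := dft_decay N k m D B HN HD HP HB).
  assert (H2 := dft_fourier N k 0 D B HN HD HP HB HM).
  set (X := dft N (fun j => D 0%nat (grid N j)) k) in *. set (Y := fourier (D 0%nat) k) in *.
  assert (H3 : Cmod Y <= Cmod X + Cmod (X - Y)%C).
  { replace Y with (X - (X - Y))%C at 1 by ring. apply Cmod_minus_le. }
  assert (H4 : Rabs (IZR k) * mesh N <= PI) by nra.
  specialize (H1 H4).
  assert (H5 : mesh N * Q <= eps).
  { assert (2 * PI * Q / eps < INR N) by lra.
    assert (2 * PI * Q < INR N * eps).
    { replace (2 * PI * Q) with (2 * PI * Q / eps * eps) by (field; lra).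
      apply Rmult_lt_compat_r; lra. }
    rewrite <- hN in H0. nra. }
  rewrite pow_1 in H2.
  eapply Rle_trans; [apply Rmult_le_compat_r; [apply pow_le, Hk|apply H3]|].
  rewrite Rmult_plus_distr_r. apply Rplus_le_compat; [exact H1|].
  eapply Rle_trans; [apply Rmult_le_compat_r; [apply pow_le, Hk|apply H2]|].
  eapply Rle_trans; [|exact H5]. unfold Q. apply Req_le. ring.
Qed.

(** * Consistency of the filtered operator *)

Lemma csum_first (f : nat -> C) (N : nat) :
  csum f (S N) = (f 1%nat + csum (fun j => f (S j)) N)%C.
Proof.
  induction N as [|N IH].
  - rewrite csum_S, !csum_0. ring.
  - rewrite csum_S, IH, csum_S. ring.
Qed.

Lemma csum_centered (F : Z -> C) (m p : nat) :
  csum (fun i => F (Z.of_nat i - Z.of_nat m)%Z) (m + p)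
    = (csum (fun i => F (1 - Z.of_nat i)%Z) m + csum (fun i => F (Z.of_nat i)) p)%C.
Proof.
  induction m as [|m IH].
  - rewrite csum_0. simpl (0 + p)%nat.
    rewrite (csum_ext _ (fun i => F (Z.of_nat i))); [ring|].
    intros; f_equal; lia.
  - simpl (S m + p)%nat. rewrite csum_first, csum_S.
    rewrite (csum_ext _ (fun i => F (Z.of_nat i - Z.of_nat m)%Z)) by (intros; f_equal; lia).
    rewrite IH. replace (Z.of_nat 1 - Z.of_nat (S m))%Z with (1 - Z.of_nat (S m))%Z by lia. ring.
Qed.

Lemma csum_freq (F : Z -> C) (p : nat) : F 0%Z = 0%C ->
  csum (fun i => F (freq (2 * S p) i)) (2 * S p)
    = csum (fun n => if Nat.leb n p then F (Z.of_nat n) + F (- Z.of_nat n)%Z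
                     else F (Z.of_nat n))%C (S p).
Proof.
  intros F0.
  rewrite (csum_ext _ (fun i => F (Z.of_nat i - Z.of_nat (S p))%Z)).
  2: { intros i _. unfold freq. rewrite Nat.mul_comm, Nat.div_mul by lia. reflexivity. }
  replace (2 * S p)%nat with (S p + S p)%nat by lia.
  rewrite csum_centered, csum_first.
  replace (1 - Z.of_nat 1)%Z with 0%Z by lia. rewrite F0, !csum_S.
  replace (Nat.leb (S p) p) with false by (symmetry; apply Nat.leb_gt; lia).
  rewrite (csum_ext (fun n => if Nat.leb n p then _ else _)
     (fun n => F (Z.of_nat n) + F (- Z.of_nat n)%Z)%C).
  - rewrite csum_plus.
    rewrite (csum_ext (fun j => F (1 - Z.of_nat (S j))%Z) (fun n => F (- Z.of_nat n)%Z))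
      by (intros; f_equal; lia).
    ring.
  - intros j Hj. replace (Nat.leb j p) with true by (symmetry; apply Nat.leb_le; lia). reflexivity.
Qed.

(** A telescoping substitute for 1 / n^2, defined also at n = 0. The 6 makes it dominate 1 / n^2 for
    n >= 1, with equality at n = 1, and its sum is again 6. *)
Definition summable_weight (n : nat) : R := 6 / ((INR n + 1) * (INR n + 2)).

Lemma is_series_summable_weight : is_series summable_weight 6.
Proof.
  assert (H : forall n, sum_n summable_weight n = 6 - 6 / (INR n + 2)).
  { induction n as [|n IH].
    - rewrite sum_O. unfold summable_weight. simpl. field.
    - rewrite sum_Sn, IH. unfold summable_weight, plus. rewrite S_INR.
      generalize (pos_INR n); intros. simpl. field. lra. }
  change (is_lim_seq (sum_n summable_weight) 6).
  apply is_lim_seq_ext with (fun n => 6 - 6 / (INR n + 2)); [intros; symmetry; apply H|].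
  evar_last.
  - apply is_lim_seq_minus'; [apply is_lim_seq_const|].
    apply is_lim_seq_div with (l1 := 6) (l2 := p_infty).
    + apply is_lim_seq_const.
    + apply is_lim_seq_plus with (l1 := p_infty) (l2 := 2);
        [apply is_lim_seq_INR|apply is_lim_seq_const|reflexivity].
    + discriminate.
    + unfold is_Rbar_div, is_Rbar_mult. simpl. rewrite Rmult_0_r. reflexivity.
  - simpl. f_equal. ring.
Qed.

Lemma summable_weight_pos (n : nat) : 0 < summable_weight n.
Proof. unfold summable_weight. generalize (pos_INR n); intros. apply Rdiv_lt_0_compat; nra. Qed.

Lemma le_summable_weight (n : nat) (z A : R) : (0 < n)%nat -> 0 <= z ->
  z * INR n ^ 2 <= A -> z <= A * summable_weight n.
Proof.
  intros Hn Hz H. unfold summable_weight.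
  assert (1 <= INR n) by (apply (le_INR 1); lia).
  apply Rmult_le_reg_r with ((INR n + 1) * (INR n + 2)); [nra|].
  replace (A * (6 / ((INR n + 1) * (INR n + 2))) * ((INR n + 1) * (INR n + 2))) with (6 * A) by (field; lra).
  assert ((INR n + 1) * (INR n + 2) <= 6 * INR n ^ 2) by (simpl; nra).
  apply Rle_trans with (z * (6 * INR n ^ 2)); [apply Rmult_le_compat_l; assumption|lra].
Qed.

Lemma is_series_finite (a : nat -> R) (P : nat) :
  a 0%nat = 0 -> (forall n, (P < n)%nat -> a n = 0) -> is_series a (rsum a P).
Proof.
  intros H0 H.
  assert (E : forall n, sum_n a n = rsum a n).
  { intros n. unfold sum_n, rsum. rewrite (sum_n_m_Chasles a 0 0 n) by lia.
    rewrite sum_n_n, H0. apply Rplus_0_l. }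
  assert (E' : forall n, rsum a (n + P) = rsum a P).
  { induction n as [|n IH]; [reflexivity|]. change (S n + P)%nat with (S (n + P)). rewrite rsum_S, IH, (H (S (n + P))) by lia.
    apply Rplus_0_r. }
  change (is_lim_seq (sum_n a) (rsum a P)).
  apply is_lim_seq_incr_n with P.
  apply is_lim_seq_ext with (fun _ => rsum a P); [|apply is_lim_seq_const].
  intros n. now rewrite E, E'.
Qed.

(** Extended by zero, the finite sum becomes a series, so the errors of the modes on the grid and
    the truncated tail are handled by a single comparison with [summable_weight]. The bound with
    [A1] supplies the convergence of [a]; only [A] enters the result. *)
Lemma finite_sum_minus_Series (a b : nat -> R) (P : nat) (A1 A : R) :
  b 0%nat = 0 -> (forall n, (P < n)%nat -> b n = 0) ->
  (forall n, Rabs (a n) <= A1 * summable_weight n) ->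
  (forall n, Rabs (b n - a n) <= A * summable_weight n) ->
  Rabs (rsum b P - Series a) <= A * 6.
Proof.
  intros b0 bP Ha Hab.
  assert (Hb := is_series_finite b P b0 bP).
  assert (Ew : ex_series summable_weight) by (exists 6; exact is_series_summable_weight).
  assert (Ea : ex_series a).
  { apply (ex_series_le (V := R_CompleteNormedModule) a (fun n => A1 * summable_weight n)); [exact Ha|].
    apply (ex_series_scal (V := R_NormedModule) A1 summable_weight Ew). }
  rewrite <- (is_series_unique _ _ Hb), <- Series_minus; [|exists (rsum b P); exact Hb|exact Ea].
  assert (EA : ex_series (fun n => A * summable_weight n))
    by apply (ex_series_scal (V := R_NormedModule) A summable_weight Ew).
  eapply Rle_trans; [apply Series_Rabs|].
  - apply (ex_series_le (V := R_CompleteNormedModule) (fun n => Rabs (b n - a n)) (fun n => A * summable_weight n)); [|exact EA].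
    intros n. unfold norm; simpl. unfold abs; simpl. rewrite Rabs_Rabsolu. apply Hab.
  - rewrite <- (is_series_unique _ _ is_series_summable_weight), <- Series_scal_l.
    apply Series_le; [|exact EA]. intros n. split; [apply Rabs_pos|apply Hab].
Qed.

Lemma pow_mult_le_1 (x : R) (n : nat) : 0 <= x <= 1 -> x ^ n <= 1.
Proof. intros Hx. rewrite <- (pow1 n). apply pow_incr, Hx. Qed.

(** Evenness carries the bound over to negative arguments. The value at PI, taken at the unpaired
    frequency, is left out and later enters through [rho PI] itself. *)
Lemma filter_bound (r : nat) (rho : R -> R) : filter_function r rho ->
  exists K, 0 <= K /\ forall xi, xi <> 0 -> Rabs xi < PI -> Rabs (rho xi - 1) <= K * Rabs xi ^ r.
Proof.
  intros [_ He _ [K HK]]. exists (Rabs K). split; [apply Rabs_pos|].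
  assert (Hp : forall xi, 0 < xi < PI -> Rabs (rho xi - 1) <= Rabs K * Rabs xi ^ r).
  { intros xi Hxi. specialize (HK xi Hxi).
    assert (Hpow : 0 < Rabs xi ^ r) by (apply pow_lt, Rabs_pos_lt; lra).
    apply Rle_trans with (K * Rabs xi ^ r).
    - apply Rmult_le_reg_l with (/ Rabs xi ^ r); [apply Rinv_0_lt_compat, Hpow|].
      replace (/ Rabs xi ^ r * (K * Rabs xi ^ r)) with K by (field; lra). exact HK.
    - apply Rmult_le_compat_r; [lra|apply Rle_abs]. }
  intros xi Hxi Hlt. apply Rabs_def2 in Hlt.
  destruct (Rlt_dec 0 xi); [apply Hp; lra|].
  rewrite <- (He xi), <- (Rabs_Ropp xi) by lra. apply Hp. lra.
Qed.

(** * Mode by mode comparison for one function on one grid *)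

Section Consistency.

Variables (r : nat) (rho : R -> R) (K : R) (B : nat -> R) (D : nat -> R -> C) (p : nat).
Hypothesis K_pos : 0 <= K.
Hypothesis rho_pi : 0 <= rho PI.
Hypothesis rho_K : forall xi, xi <> 0 -> Rabs xi < PI -> Rabs (rho xi - 1) <= K * Rabs xi ^ r.
Hypothesis D_tower : Ctower D.
Hypothesis D_periodic : forall x, D 0%nat (x + 2 * PI) = D 0%nat x.
Hypothesis D_bound : forall a x, Cmod (D a x) <= B a.
Hypothesis B_mono : forall a, B a <= B (S a).

Let N := (2 * S p)%nat.
Let h := mesh N.
Let dhat (k : Z) : C := dft N (fun j => D 0%nat (grid N j)) k.
Let fhat (k : Z) : C := fourier (D 0%nat) k.

Let N_pos : (0 < N)%nat. Proof. unfold N. lia. Qed.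
Let h_pos : 0 < h. Proof. apply mesh_pos, N_pos. Qed.
Let h_half : INR (S p) * h = PI.
Proof. assert (E := mesh_INR N N_pos). fold h in E. unfold N in E. rewrite mult_INR in E. simpl (INR 2) in E. lra. Qed.
Let B_pos (a : nat) : 0 <= B a.
Proof. apply Rle_trans with (2 := D_bound a 0), Cmod_ge_0. Qed.

(* When [h k^2 <= 1] the trapezoid rule is accurate enough; otherwise both
   coefficients are already small. *)
Lemma dft_fourier_cubic (k : Z) : 1 <= Rabs (IZR k) -> Rabs (IZR k) * h <= PI ->
  Rabs (IZR k) ^ 3 * Cmod (dhat k - fhat k)%C <= 2 * 12 ^ (2 * r + 3) * B (2 * r + 3)%nat * h ^ r.
Proof.
  (* This [m] fits both cases: x^3 (h x)^m = h^r (h x^2)^(r + 3) and x^3 (h x^2)^r = x^m h^r. The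
     base 12 covers the factor 2 per order in the first case, from 1 + x <= 2 x, and the 6 of the
     decay estimates in the second. *)
  intros Hk1 Hk2. set (x := Rabs (IZR k)) in *. set (m := (2 * r + 3)%nat).
  assert (Bm := B_pos m). assert (hr : 0 < h ^ r) by (apply pow_lt, h_pos).
  destruct (Rle_dec (h * x ^ 2) 1) as [Hs|Hl].
  - assert (H := dft_fourier N k (2 * r + 2) D B N_pos D_tower D_periodic D_bound B_mono).
    fold (dhat k) (fhat k) h x in H. replace (S (2 * r + 2)) with m in H by (unfold m; lia).
    apply Rle_trans with (x ^ 3 * (2 * (2 * (h * x)) ^ m * B m)).
    + apply Rmult_le_compat_l; [apply pow_le; lra|].
      eapply Rle_trans; [exact H|]. apply Rmult_le_compat_r; [exact Bm|].
      apply Rmult_le_compat_l; [lra|]. apply pow_incr. nra.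
    + replace (x ^ 3 * (2 * (2 * (h * x)) ^ m * B m))
        with (2 * B m * 2 ^ m * (h ^ r * (h * x ^ 2) ^ (r + 3))).
      * assert (0 <= (h * x ^ 2) ^ (r + 3) <= 1).
        { assert (0 <= x ^ 2) by (apply pow_le; lra).
          split; [apply pow_le; nra|apply pow_mult_le_1; nra]. }
        assert (2 ^ m <= 12 ^ m) by (apply pow_incr; lra).
        assert (0 < 2 ^ m) by (apply pow_lt; lra).
        apply Rle_trans with (2 * B m * 2 ^ m * h ^ r).
        -- apply Rmult_le_compat_l; [|nra]. apply Rmult_le_pos; lra.
        -- apply Rmult_le_compat_r; [lra|]. nra.
      * rewrite !Rpow_mult_distr, <- pow_mult.
        replace (2 * (r + 3))%nat with (m + 3)%nat by (unfold m; lia).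
        assert (Eh : h ^ m = h ^ r * h ^ (r + 3)) by (rewrite <- pow_add; f_equal; unfold m; lia).
        rewrite Eh, (pow_add x m 3). ring.
  - assert (H1 := dft_decay N k m D B N_pos D_tower D_periodic D_bound Hk2).
    assert (H2 := fourier_decay k m D B D_tower D_periodic D_bound B_mono).
    fold (dhat k) x in H1. fold (fhat k) x in H2.
    assert (H3 := Cmod_minus_le (dhat k) (fhat k)).
    assert (1 <= (h * x ^ 2) ^ r) by (apply pow_R1_Rle; lra).
    assert (H4 := Cmod_ge_0 (dhat k - fhat k)%C). set (z := Cmod (dhat k - fhat k)%C) in *.
    assert (x3 : 0 < x ^ 3) by (apply pow_lt; lra).
    (* A factor that is at least 1 in this case turns 2 r powers of x, which the decay affords, into
       h^r. *)
    apply Rle_trans with (x ^ 3 * z * (h * x ^ 2) ^ r).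
    { rewrite <- (Rmult_1_r (x ^ 3 * z)) at 1. apply Rmult_le_compat_l; [|assumption].
      apply Rmult_le_pos; lra. }
    replace (x ^ 3 * z * (h * x ^ 2) ^ r) with (z * x ^ m * h ^ r).
    + apply Rmult_le_compat_r; [lra|].
      apply Rle_trans with (2 * (6 ^ m * B m)).
      * assert (0 < x ^ m) by (apply pow_lt; lra).
        apply Rle_trans with ((Cmod (dhat k) + Cmod (fhat k)) * x ^ m); [apply Rmult_le_compat_r; lra|lra].
      * assert (6 ^ m <= 12 ^ m) by (apply pow_incr; lra). nra.
    + unfold m. rewrite Rpow_mult_distr, pow_add, <- pow_mult. ring.
Qed.

(** For frequencies of size N / 2 or more one has 1 <= x h, so r spare powers of x are worth h^r. *)
Lemma high_mode (x z A : R) : PI <= x * h -> 0 <= x -> 0 <= z -> z * x ^ (r + 3) <= A ->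
  z * x ^ 3 <= A * h ^ r.
Proof.
  intros Hx Hx0 Hz HA.
  assert (1 <= (x * h) ^ r) by (apply pow_R1_Rle; generalize PI2_1; lra).
  apply Rle_trans with (z * x ^ (r + 3) * h ^ r);
    [|apply Rmult_le_compat_r; [apply pow_le; lra|exact HA]].
  replace (z * x ^ (r + 3) * h ^ r) with (z * x ^ 3 * (x * h) ^ r)
    by (rewrite pow_add, Rpow_mult_distr; ring).
  assert (0 <= z * x ^ 3) by (apply Rmult_le_pos; [lra|apply pow_le; lra]). nra.
Qed.

Let E0 : R := 6 ^ (r + 3) * B (r + 3)%nat.
(** The summands are, in this order, the filter error at the paired frequencies, the mode N / 2 of
    the filtered operator, the tail of the exact series, and the difference of discrete and
    continuous coefficients. The factor 2 accounts for the pair n, - n. *)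
Definition consistency_const : R :=
  2 * (K * E0 + rho PI * E0 + E0 + 2 * 12 ^ (2 * r + 3) * B (2 * r + 3)%nat).

Let E0_pos : 0 <= E0.
Proof. unfold E0. apply Rmult_le_pos; [apply pow_le; lra|apply B_pos]. Qed.

Let C2_pos : 0 <= 2 * 12 ^ (2 * r + 3) * B (2 * r + 3)%nat.
Proof. repeat apply Rmult_le_pos; [lra|apply pow_le; lra|apply B_pos]. Qed.

Lemma consistency_const_pos : 0 <= consistency_const.
Proof.
  unfold consistency_const. assert (0 <= K * E0) by (apply Rmult_le_pos; assumption).
  assert (0 <= rho PI * E0) by (apply Rmult_le_pos; assumption). lra.
Qed.

Variable j : nat.
Let F (k : Z) : C :=
  (RtoC (rho (h * IZR k) * IZR (Z.abs k))%R * dhat k * expi (IZR k * grid N j))%C.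
Let G (k : Z) : C := Lambda_mode (D 0%nat) (grid N j) k.

Let Cmod_G (k : Z) : Cmod (G k) = Rabs (IZR k) * Cmod (fhat k).
Proof.
  unfold G, Lambda_mode. rewrite !Cmod_mult, Cmod_expi, Cmod_R, abs_IZR, Rabs_Rabsolu.
  unfold fhat. ring.
Qed.

Let G_bound (k : Z) : PI <= Rabs (IZR k) * h -> Rabs (IZR k) ^ 2 * Cmod (G k) <= E0 * h ^ r.
Proof.
  intros Hk. rewrite Cmod_G.
  replace (Rabs (IZR k) ^ 2 * (Rabs (IZR k) * Cmod (fhat k)))
    with (Cmod (fhat k) * Rabs (IZR k) ^ 3) by ring.
  apply high_mode; [exact Hk|apply Rabs_pos|apply Cmod_ge_0|].
  apply (fourier_decay k (r + 3) D B); assumption.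
Qed.

Let G_decay (k : Z) : Rabs (IZR k) ^ 2 * Cmod (G k) <= 6 ^ 3 * B 3%nat.
Proof.
  rewrite Cmod_G.
  replace (Rabs (IZR k) ^ 2 * (Rabs (IZR k) * Cmod (fhat k)))
    with (Cmod (fhat k) * Rabs (IZR k) ^ 3) by ring.
  apply (fourier_decay k 3 D B); assumption.
Qed.

(** Here h k is exactly PI. The mode is of order h^r by decay alone, so [rho PI] may be any
    nonnegative number and need not be close to 1. *)
Let F_nyquist : INR (S p) ^ 2 * Cmod (F (Z.of_nat (S p))) <= rho PI * E0 * h ^ r.
Proof.
  unfold F. rewrite !Cmod_mult, Cmod_expi, Cmod_R.
  rewrite Z.abs_eq by lia. rewrite <- INR_IZR_INZ, (Rmult_comm h), h_half, Rmult_1_r.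
  assert (xpos := pos_INR (S p)).
  rewrite Rabs_pos_eq by (apply Rmult_le_pos; assumption).
  replace (INR (S p) ^ 2 * (rho PI * INR (S p) * Cmod (dhat (Z.of_nat (S p)))))
    with (rho PI * (Cmod (dhat (Z.of_nat (S p))) * INR (S p) ^ 3)) by ring.
  rewrite Rmult_assoc. apply Rmult_le_compat_l; [exact rho_pi|].
  apply high_mode; [lra|exact xpos|apply Cmod_ge_0|].
  assert (H := dft_decay N (Z.of_nat (S p)) (r + 3) D B N_pos D_tower D_periodic D_bound).
  rewrite <- INR_IZR_INZ, (Rabs_pos_eq (INR (S p))) in H by exact xpos.
  apply H. fold h. lra.
Qed.

(** The difference splits into |k| (rho - 1) dhat and |k| (dhat - fhat). In the first, the filter
    condition gives (h |k|)^r and the decay of [dhat] absorbs |k|^r; the second is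
    [dft_fourier_cubic]. *)
Let FG_low (k : Z) : 1 <= Rabs (IZR k) -> Rabs (IZR k) * h < PI ->
  Rabs (IZR k) ^ 2 * Cmod (F k - G k)%C
    <= (K * E0 + 2 * 12 ^ (2 * r + 3) * B (2 * r + 3)%nat) * h ^ r.
Proof.
  intros H1 H2.
  assert (E : (F k - G k = RtoC (Rabs (IZR k)) * ((RtoC (rho (h * IZR k)) - 1) * dhat k
     + (dhat k - fhat k)) * expi (IZR k * grid N j))%C).
  { unfold F, G, Lambda_mode. rewrite abs_IZR, RtoC_mult. fold (fhat k). ring. }
  rewrite E, !Cmod_mult, Cmod_expi, Cmod_R, Rabs_Rabsolu, Rmult_1_r.
  set (x := Rabs (IZR k)) in *.
  replace (x ^ 2 * (x * Cmod ((RtoC (rho (h * IZR k)) - 1) * dhat k + (dhat k - fhat k))))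
    with (x ^ 3 * Cmod ((RtoC (rho (h * IZR k)) - 1) * dhat k + (dhat k - fhat k))%C) by ring.
  assert (x3 : 0 < x ^ 3) by (apply pow_lt; lra).
  eapply Rle_trans; [apply Rmult_le_compat_l; [lra|apply Cmod_triangle]|].
  rewrite Rmult_plus_distr_l, Rmult_plus_distr_r. apply Rplus_le_compat.
  - rewrite Cmod_mult, <- RtoC_minus, Cmod_R.
    assert (Hx : Rabs (h * IZR k) = x * h)
      by (rewrite Rabs_mult, (Rabs_pos_eq h) by lra; apply Rmult_comm).
    assert (R1 : Rabs (rho (h * IZR k) - 1) <= K * (x * h) ^ r).
    { rewrite <- Hx. apply rho_K; [|lra].
      intros E1. rewrite E1, Rabs_R0 in Hx. nra. }
    assert (R2 := dft_decay N k (r + 3) D B N_pos D_tower D_periodic D_bound (Rlt_le _ _ H2)).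
    fold (dhat k) x in R2.
    assert (R3 := Cmod_ge_0 (dhat k)).
    apply Rle_trans with (x ^ 3 * (K * (x * h) ^ r * Cmod (dhat k))).
    + apply Rmult_le_compat_l; [lra|]. apply Rmult_le_compat_r; assumption.
    + replace (x ^ 3 * (K * (x * h) ^ r * Cmod (dhat k))) with (K * (Cmod (dhat k) * x ^ (r + 3)) * h ^ r)
        by (rewrite pow_add, Rpow_mult_distr; ring).
      apply Rmult_le_compat_r; [apply pow_le; lra|]. apply Rmult_le_compat_l; [exact K_pos|exact R2].
  - apply dft_fourier_cubic; [exact H1|apply Rlt_le, H2].
Qed.

(** [a] lists the paired terms of [Lambda], and [b] those of the filtered operator as in
    [csum_freq], continued by zero beyond N / 2. *)
Let a (n : nat) : C := (G (Z.of_nat n) + G (- Z.of_nat n))%C.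
Let b (n : nat) : C :=
  if Nat.leb n (S p) then
    if Nat.leb n p then (F (Z.of_nat n) + F (- Z.of_nat n))%C else F (Z.of_nat n)
  else 0%C.

Let Rabs_nat (n : nat) : Rabs (IZR (Z.of_nat n)) = INR n.
Proof. rewrite <- INR_IZR_INZ. apply Rabs_pos_eq, pos_INR. Qed.
Let Rabs_nat_opp (n : nat) : Rabs (IZR (- Z.of_nat n)) = INR n.
Proof. rewrite opp_IZR, Rabs_Ropp. apply Rabs_nat. Qed.

Let F_0 : F 0%Z = 0%C.
Proof. unfold F. simpl. rewrite Rmult_0_r. ring. Qed.
Let a_0 : a 0%nat = 0%C.
Proof. unfold a, G, Lambda_mode. simpl. ring. Qed.
Let b_0 : b 0%nat = 0%C.
Proof. unfold b. simpl. rewrite F_0. ring. Qed.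

Let a_bound (n : nat) : Cmod (a n) <= 2 * (6 ^ 3 * B 3%nat) * summable_weight n.
Proof.
  assert (B3 := B_pos 3).
  destruct n as [|n].
  - rewrite a_0, Cmod_0. assert (H := summable_weight_pos 0). apply Rmult_le_pos; [|lra]. lra.
  - apply le_summable_weight; [lia|apply Cmod_ge_0|].
    assert (H1 := G_decay (Z.of_nat (S n))). assert (H2 := G_decay (- Z.of_nat (S n))).
    rewrite Rabs_nat in H1. rewrite Rabs_nat_opp in H2.
    assert (H3 := Cmod_triangle (G (Z.of_nat (S n))) (G (- Z.of_nat (S n)))). fold (a (S n)) in H3.
    assert (H4 : 0 <= INR (S n) ^ 2) by (apply pow_le, pos_INR). nra.
Qed.

Let ab_bound (n : nat) : Cmod (b n - a n)%C <= consistency_const * h ^ r * summable_weight n.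
Proof.
  assert (hr : 0 < h ^ r) by (apply pow_lt, h_pos).
  destruct n as [|n].
  { rewrite a_0, b_0. replace (0 - 0)%C with (RtoC 0) by ring. rewrite Cmod_0.
    assert (H := summable_weight_pos 0). assert (H' := consistency_const_pos).
    apply Rmult_le_pos; [|lra]. apply Rmult_le_pos; lra. }
  apply le_summable_weight; [lia|apply Cmod_ge_0|].
  assert (Hn : 1 <= INR (S n)) by (apply (le_INR 1); lia).
  assert (n2 : 0 < INR (S n) ^ 2) by (apply pow_lt; lra).
  assert (P1 : 0 <= K * E0 * h ^ r) by (apply Rmult_le_pos; [apply Rmult_le_pos; assumption|lra]).
  assert (P2 : 0 <= rho PI * E0 * h ^ r) by (apply Rmult_le_pos; [apply Rmult_le_pos; assumption|lra]).
  assert (P3 : 0 <= E0 * h ^ r) by (apply Rmult_le_pos; [assumption|lra]).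
  assert (P4 : 0 <= 2 * 12 ^ (2 * r + 3) * B (2 * r + 3)%nat * h ^ r) by (apply Rmult_le_pos; [assumption|lra]).
  unfold consistency_const.
  destruct (le_lt_dec (S n) p) as [Hlow|Hhigh].
  - unfold b. replace (Nat.leb (S n) (S p)) with true by (symmetry; apply Nat.leb_le; lia).
    replace (Nat.leb (S n) p) with true by (symmetry; apply Nat.leb_le; lia). unfold a.
    set (k := Z.of_nat (S n)).
    replace (F k + F (- k) - (G k + G (- k)))%C with ((F k - G k) + (F (- k) - G (- k)))%C by ring.
    assert (Hh : INR (S n) * h < PI).
    { rewrite <- h_half. apply Rmult_lt_compat_r; [exact h_pos|]. apply lt_INR. lia. }
    assert (H1 := FG_low k). assert (H2 := FG_low (- k)). unfold k in H1, H2.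
    rewrite Rabs_nat in H1. rewrite Rabs_nat_opp in H2. specialize (H1 Hn Hh). specialize (H2 Hn Hh).
    fold k in H1, H2.
    assert (H3 := Cmod_triangle (F k - G k)%C (F (- k) - G (- k))%C). nra.
  (* From N / 2 on there is no cancellation to use: both terms are small separately, and beyond N /
     2 the term [b] is zero. *)
  - assert (Hh : PI <= INR (S n) * h).
    { rewrite <- h_half. apply Rmult_le_compat_r; [apply Rlt_le, h_pos|]. apply le_INR. lia. }
    assert (H1 := G_bound (Z.of_nat (S n))). assert (H2 := G_bound (- Z.of_nat (S n))).
    rewrite Rabs_nat in H1. rewrite Rabs_nat_opp in H2. specialize (H1 Hh). specialize (H2 Hh).
    assert (H3 := Cmod_triangle (G (Z.of_nat (S n))) (G (- Z.of_nat (S n)))). fold (a (S n)) in H3.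
    assert (H4 := Cmod_minus_le (b (S n)) (a (S n))).
    assert (H5 : INR (S n) ^ 2 * Cmod (b (S n)) <= rho PI * E0 * h ^ r).
    { unfold b. destruct (Nat.leb (S n) (S p)) eqn:L1.
      - apply Nat.leb_le in L1. replace n with p by lia.
        replace (Nat.leb (S p) p) with false by (symmetry; apply Nat.leb_gt; lia).
        exact F_nyquist.
      - rewrite Cmod_0. lra. }
    nra.
Qed.

Lemma consistency_aux :
  Cmod (filtered_Lambda N rho (fun i => D 0%nat (grid N i)) j - Lambda (D 0%nat) (grid N j))%C
    <= 2 * (consistency_const * h ^ r * 6).
Proof.
  assert (E : filtered_Lambda N rho (fun i => D 0%nat (grid N i)) j = csum b (S p)).
  { change (csum (fun i => F (freq (2 * S p) i)) (2 * S p) = csum b (S p)).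
    rewrite csum_freq by exact F_0. apply csum_ext. intros n Hn. unfold b.
    replace (Nat.leb n (S p)) with true by (symmetry; apply Nat.leb_le; lia). reflexivity. }
  assert (bP : forall n, (S p < n)%nat -> b n = 0%C).
  { intros n Hn. unfold b. replace (Nat.leb n (S p)) with false by (symmetry; apply Nat.leb_gt; lia).
    reflexivity. }
  rewrite E. eapply Rle_trans; [apply Cmod_le_abs|].
  assert (H1 := finite_sum_minus_Series (fun n => fst (a n)) (fun n => fst (b n)) (S p)
    (2 * (6 ^ 3 * B 3%nat)) (consistency_const * h ^ r) (f_equal fst b_0)
    (fun n Hn => f_equal fst (bP n Hn))
    (fun n => Rle_trans _ _ _ (fst_le_Cmod _) (a_bound n))
    (fun n => Rle_trans _ _ _ (fst_le_Cmod (b n - a n)) (ab_bound n))).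
  assert (H2 := finite_sum_minus_Series (fun n => snd (a n)) (fun n => snd (b n)) (S p)
    (2 * (6 ^ 3 * B 3%nat)) (consistency_const * h ^ r) (f_equal snd b_0)
    (fun n Hn => f_equal snd (bP n Hn))
    (fun n => Rle_trans _ _ _ (snd_le_Cmod _) (a_bound n))
    (fun n => Rle_trans _ _ _ (snd_le_Cmod (b n - a n)) (ab_bound n))).
  rewrite <- csum_fst in H1. rewrite <- csum_snd in H2.
  change (Rabs (fst (csum b (S p)) - Series (fun n => fst (a n)))
    + Rabs (snd (csum b (S p)) - Series (fun n => snd (a n))) <= 2 * (consistency_const * h ^ r * 6)).
  lra.
Qed.

End Consistency.

(** The constant is chosen before [D], [N] and [j] and sees the function only through the bounds
    [B]; this is what makes it serve all times and all grids at once. *)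
Lemma filtered_Lambda_consistent (r : nat) (rho : R -> R) (B : nat -> R) :
  filter_function r rho -> (forall a, B a <= B (S a)) ->
  exists A, 0 <= A /\ forall D N j, (0 < N)%nat -> Nat.Even N -> Ctower D ->
    (forall x, D 0%nat (x + 2 * PI) = D 0%nat x) -> (forall a x, Cmod (D a x) <= B a) ->
    Cmod (filtered_Lambda N rho (fun i => D 0%nat (grid N i)) j - Lambda (D 0%nat) (grid N j))%C
      <= A * mesh N ^ r.
Proof.
  intros Hrho HM. destruct (filter_bound r rho Hrho) as [K [HK HrK]].
  assert (Hpi : 0 <= rho PI).
  { apply (filter_nonneg r rho Hrho). unfold filter_dom. generalize PI_RGT_0. lra. }
  exists (Rabs (12 * consistency_const r rho K B)). split; [apply Rabs_pos|].
  intros D N j HN [q Hq] HD HP HB. destruct q as [|p]; [lia|]. subst N.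
  eapply Rle_trans; [apply (consistency_aux r rho K B D p); assumption|].
  generalize (pow_le (mesh (2 * S p)) r (Rlt_le _ _ (mesh_pos _ HN))).
  generalize (Rle_abs (12 * consistency_const r rho K B)). intros. nra.
Qed.

(** * Discrete energy estimate *)

Definition inner (z w : C) : R := fst z * fst w + snd z * snd w.

Lemma inner_conj (z w : C) : inner z w = fst (Cconj z * w)%C.
Proof. unfold inner. simpl. ring. Qed.

Lemma Cmod2_inner (z : C) : Cmod z ^ 2 = inner z z.
Proof. rewrite Cmod2_alt. unfold inner, Re, Im. ring. Qed.

Lemma inner_le (z w : C) : 2 * Rabs (inner z w) <= Cmod z ^ 2 + Cmod w ^ 2.
Proof.
  rewrite !Cmod2_inner. destruct z as [a b], w as [x y]. unfold inner. simpl.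
  generalize (pow2_ge_0 (a - x)) (pow2_ge_0 (b - y)) (pow2_ge_0 (a + x)) (pow2_ge_0 (b + y)).
  unfold Rabs. destruct (Rcase_abs _); lra.
Qed.

(** * Orthogonality, Parseval's identity and duality *)

Lemma expi_neq_1 (y : R) : y <> 0 -> Rabs y < 2 * PI -> expi y <> 1%C.
Proof.
  intros H0 H1 E. assert (Ppos := PI_RGT_0).
  assert (H : forall z, z <> 0 -> Rabs z <= PI -> expi z <> 1%C).
  { intros z Hz Hz' E'. assert (H := Cmod_expi_minus_1 z Hz').
    rewrite E' in H. replace (1 - 1)%C with (RtoC 0) in H by ring. rewrite Cmod_0 in H.
    generalize (Rabs_pos_lt z Hz). lra. }
  apply Rabs_def2 in H1.
  destruct (Rle_dec (Rabs y) PI) as [Hle|Hgt]; [exact (H y H0 Hle E)|].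
  destruct (Rle_dec 0 y).
  - rewrite Rabs_pos_eq in Hgt by lra.
    apply (H (y - 2 * PI)); [lra|rewrite Rabs_left1; lra|].
    replace (y - 2 * PI) with (y + IZR (-1) * (2 * PI)) by ring.
    rewrite expi_plus, expi_periodic, E. ring.
  - rewrite Rabs_left1 in Hgt by lra.
    apply (H (y + 2 * PI)); [lra|rewrite Rabs_pos_eq; lra|].
    replace (y + 2 * PI) with (y + IZR 1 * (2 * PI)) by ring.
    rewrite expi_plus, expi_periodic, E. ring.
Qed.

(** The geometric sum with its denominator cleared, which keeps the induction free of division. *)
Lemma csum_expi_arith (x y : R) (N : nat) :
  (csum (fun i => expi (x + INR i * y)) N * (expi y - 1)
    = expi (x + y) * (expi (INR N * y) - 1))%C.
Proof.
  induction N as [|N IH].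
  - rewrite csum_0. simpl INR. rewrite Rmult_0_l, expi_0. ring.
  - rewrite csum_S, Cmult_plus_distr_r, IH, S_INR, Rmult_plus_distr_r, Rmult_1_l.
    rewrite !expi_plus. ring.
Qed.

(** The frequencies are consecutive, so off the diagonal this is a geometric sum with ratio exp (i
    y), y = (l - j) h. It vanishes because exp (i N y) = 1, while the ratio differs from 1 as 0 <
    |y| < 2 PI. *)
Lemma csum_expi_orthogonal (N j l : nat) : (1 <= j <= N)%nat -> (1 <= l <= N)%nat ->
  csum (fun i => expi (IZR (freq N i) * (grid N l - grid N j))) N
    = if Nat.eqb l j then RtoC (INR N) else 0%C.
Proof.
  intros Hj Hl. assert (HN : (0 < N)%nat) by lia. assert (hN := mesh_INR N HN). assert (hpos := mesh_pos N HN).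
  destruct (Nat.eqb_spec l j) as [->|Hne].
  - rewrite (csum_ext _ (fun _ => RtoC 1)).
    + rewrite csum_RtoC, rsum_const, Rmult_1_r. reflexivity.
    + intros i _. rewrite Rminus_diag, Rmult_0_r. apply expi_0.
  - set (y := grid N l - grid N j).
    assert (Ey : y = IZR (Z.of_nat l - Z.of_nat j) * mesh N).
    { unfold y, grid. rewrite minus_IZR, <- !INR_IZR_INZ. ring. }
    assert (H := csum_expi_arith (- IZR (Z.of_nat (N / 2)) * y) y N).
    replace (expi (INR N * y)) with (RtoC 1) in H.
    + rewrite (csum_ext _ (fun i => expi (- IZR (Z.of_nat (N / 2)) * y + INR i * y))).
      * replace (expi (- IZR (Z.of_nat (N / 2)) * y + y) * (1 - 1))%C with (RtoC 0) in H by ring.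
        assert (Hy : expi y <> 1%C).
        { apply expi_neq_1.
          - rewrite Ey. apply Rmult_integral_contrapositive_currified; [|lra].
            apply not_0_IZR. lia.
          - rewrite Ey, Rabs_mult, (Rabs_pos_eq (mesh N)), <- hN by lra.
            apply Rmult_lt_compat_r; [exact hpos|]. rewrite INR_IZR_INZ, <- abs_IZR. apply IZR_lt. lia. }
        set (s := csum _ N) in *.
        destruct (Ceq_dec s 0) as [E|E]; [exact E|].
        exfalso. apply (Cmult_neq_0 s (expi y - 1)%C); [exact E| |exact H].
        intros E'. apply Hy. replace (expi y) with ((expi y - 1) + 1)%C by ring. rewrite E'. ring.
      * intros i _. f_equal. unfold freq. rewrite minus_IZR, <- INR_IZR_INZ. ring.
    + rewrite Ey. replace (INR N * (IZR (Z.of_nat l - Z.of_nat j) * mesh N))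
        with (IZR (Z.of_nat l - Z.of_nat j) * (INR N * mesh N)) by ring.
      rewrite hN. symmetry. apply expi_periodic.
Qed.

Lemma csum_kronecker (g : nat -> C) (a : C) (j N : nat) :
  csum (fun l => g l * (if Nat.eqb l j then a else 0))%C N
    = if andb (Nat.leb 1 j) (Nat.leb j N) then (g j * a)%C else 0%C.
Proof.
  induction N as [|N IH].
  - rewrite csum_0. destruct j; reflexivity.
  - rewrite csum_S, IH. destruct (Nat.eqb_spec (S N) j) as [<-|Hne].
    + replace (Nat.leb (S N) N) with false by (symmetry; apply Nat.leb_gt; lia).
      replace (Nat.leb (S N) (S N)) with true by (symmetry; apply Nat.leb_le; lia).
      simpl. ring.
    + replace (Nat.leb j (S N)) with (Nat.leb j N); [ring|].
      destruct (Nat.leb_spec j N), (Nat.leb_spec j (S N)); try reflexivity; lia.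
Qed.

Lemma dft_csum (N : nat) (f : nat -> C) (k : Z) :
  dft N f k = (RtoC (/ INR N) * csum (fun j => f j * expi (- (IZR k * grid N j))) N)%C.
Proof. reflexivity. Qed.

Lemma Cconj_RtoC (x : R) : Cconj (RtoC x) = RtoC x.
Proof. unfold Cconj. simpl. now rewrite Ropp_0. Qed.

Lemma dft_conj (N : nat) (f : nat -> C) (k : Z) :
  Cconj (dft N f k) = (RtoC (/ INR N) * csum (fun j => Cconj (f j) * expi (IZR k * grid N j)) N)%C.
Proof.
  rewrite dft_csum, Cmult_conj, Cconj_RtoC, csum_conj. f_equal. apply csum_ext. intros j _.
  now rewrite Cmult_conj, Cconj_expi, Ropp_involutive.
Qed.

(** In the triple sum obtained by expanding the squares, the sum over frequencies is moved inside
    and leaves the diagonal. *)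
Lemma dft_parseval (N : nat) (f : nat -> C) : (0 < N)%nat ->
  rsum (fun i => Cmod (dft N f (freq N i)) ^ 2) N = / INR N * rsum (fun j => Cmod (f j) ^ 2) N.
Proof.
  intros HN. assert (Npos := lt_0_INR _ HN).
  apply RtoC_inj. rewrite RtoC_mult, <- !csum_RtoC.
  rewrite (csum_ext _ (fun i => RtoC (/ INR N) * (RtoC (/ INR N) * csum (fun j => csum (fun l =>
     Cconj (f l) * f j * expi (IZR (freq N i) * (grid N l - grid N j))) N) N)))%C.
  - rewrite csum_scal. f_equal. rewrite csum_scal.
    rewrite csum_swap. rewrite <- csum_scal. apply csum_ext. intros j Hj.
    rewrite csum_swap.
    rewrite (csum_ext _ (fun l => Cconj (f l) * f j * (if Nat.eqb l j then RtoC (INR N) else 0))%C).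
    + rewrite csum_kronecker.
      replace (Nat.leb 1 j) with true by (symmetry; apply Nat.leb_le; lia).
      replace (Nat.leb j N) with true by (symmetry; apply Nat.leb_le; lia).
      cbn [andb]. rewrite Cmod2_conj, RtoC_inv by lra. field. intros E. apply RtoC_inj in E. lra.
    + intros l Hl. rewrite csum_scal, csum_expi_orthogonal by assumption. reflexivity.
  - intros i _. rewrite Cmod2_conj, dft_conj, dft_csum.
    transitivity (RtoC (/ INR N) * (RtoC (/ INR N) *
      (csum (fun j => f j * expi (- (IZR (freq N i) * grid N j))) N *
       csum (fun j => Cconj (f j) * expi (IZR (freq N i) * grid N j)) N)))%C; [ring|].
    do 2 f_equal. rewrite Cmult_comm, <- csum_scal. apply csum_ext. intros j _.
    rewrite Cmult_comm, <- csum_scal. apply csum_ext. intros l _.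
    replace (IZR (freq N i) * (grid N l - grid N j))
      with (- (IZR (freq N i) * grid N j) + IZR (freq N i) * grid N l) by ring.
    rewrite expi_plus. ring.
Qed.

Definition symbol (N : nat) (rho : R -> R) (i : nat) : R :=
  rho (mesh N * IZR (freq N i)) * IZR (Z.abs (freq N i)).

Lemma filtered_Lambda_csum (N : nat) (rho : R -> R) (f : nat -> C) (j : nat) :
  filtered_Lambda N rho f j = csum (fun i => RtoC (symbol N rho i) * dft N f (freq N i)
       * expi (IZR (freq N i) * grid N j))%C N.
Proof. reflexivity. Qed.

Lemma filtered_Lambda_minus (N : nat) (rho : R -> R) (f g : nat -> C) (j : nat) :
  filtered_Lambda N rho (fun i => f i - g i)%C j
    = (filtered_Lambda N rho f j - filtered_Lambda N rho g j)%C.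
Proof.
  rewrite !filtered_Lambda_csum, <- csum_minus. apply csum_ext. intros i _.
  rewrite dft_minus. ring.
Qed.

(** [filtered_Lambda] is already an inverse transform, so exchanging the two sums suffices; the
    constant is N h = 2 PI. The right-hand side is symmetric in [f] and [g], which is the
    self-adjointness used in the energy estimate. *)
Lemma filtered_Lambda_duality (N : nat) (rho : R -> R) (f g : nat -> C) : (0 < N)%nat ->
  rsum (fun j => mesh N * inner (f j) (filtered_Lambda N rho g j)) N
    = 2 * PI * rsum (fun i => symbol N rho i * inner (dft N f (freq N i)) (dft N g (freq N i))) N.
Proof.
  intros HN. assert (Npos := lt_0_INR _ HN).
  assert (E : (RtoC (mesh N) * csum (fun j => Cconj (f j) * filtered_Lambda N rho g j) N
    = RtoC (2 * PI) * csum (fun i => RtoC (symbol N rho i) *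
         (Cconj (dft N f (freq N i)) * dft N g (freq N i))) N)%C).
  { rewrite (csum_ext _ (fun j => csum (fun i => RtoC (symbol N rho i) * dft N g (freq N i) *
      (Cconj (f j) * expi (IZR (freq N i) * grid N j))) N))%C.
    - rewrite csum_swap, <- !csum_scal. apply csum_ext. intros i _.
      rewrite csum_scal, dft_conj. rewrite <- (mesh_INR N HN), RtoC_mult, RtoC_inv by lra.
      field. intros H. apply RtoC_inj in H. lra.
    - intros j _. rewrite filtered_Lambda_csum, <- csum_scal. apply csum_ext. intros i _. ring. }
  rewrite <- !csum_scal in E. apply (f_equal fst) in E. rewrite !csum_fst in E.
  rewrite <- rsum_scal. etransitivity; [|etransitivity; [exact E|]]; apply rsum_ext; intros;
    rewrite inner_conj; simpl; ring.
Qed.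

(** * Time derivatives of sums, transforms and squared moduli *)

Lemma derive_within_rsum (D : R -> Prop) (f : nat -> R -> R) (f' : nat -> R) (x : R) (N : nat) :
  D x -> (forall j, (1 <= j <= N)%nat -> is_derive_within D (f j) x (f' j)) ->
  is_derive_within D (fun y => rsum (fun j => f j y) N) x (rsum f' N).
Proof.
  intros Dx. induction N as [|N IH]; intros H.
  - eapply derive_within_ext; [exact Dx| | |apply (derive_within_const D x 0)].
    + intros y _. now rewrite rsum_0.
    + now rewrite rsum_0.
  - apply (derive_within_ext D x Dx (fun y => rsum (fun j => f j y) N + f (S N) y) _
      (rsum f' N + f' (S N))); [| |apply derive_within_plus].
    + intros y _. symmetry. apply (rsum_S (fun j => f j y)).
    + symmetry. apply rsum_S.
    + apply IH. intros; apply H; lia.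
    + apply H. lia.
Qed.

Lemma derive_within_scal (D : R -> Prop) (a : R) (f : R -> R) (l x : R) :
  D x -> is_derive_within D f x l -> is_derive_within D (fun y => a * f y) x (a * l).
Proof.
  intros Dx H.
  apply (derive_within_ext D x Dx (fun y => a * f y) _ (0 * f x + a * l)); [reflexivity|ring|].
  apply derive_within_mult; [exact Dx|apply derive_within_const|exact H].
Qed.

(** Componentwise, since the energy is a real polynomial in the components; [derive_within_fst] and
    [derive_within_snd] lead here from derivatives in the complex plane. *)
Definition Cderive_within (D : R -> Prop) (z : R -> C) (x : R) (l : C) : Prop :=
  is_derive_within D (fun y => fst (z y)) x (fst l) /\
  is_derive_within D (fun y => snd (z y)) x (snd l).

Section CderiveWithin.

Variables (D : R -> Prop) (x : R).
Hypothesis Dx : D x.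

Lemma Cderive_within_minus (z w : R -> C) (a b : C) :
  Cderive_within D z x a -> Cderive_within D w x b ->
  Cderive_within D (fun y => z y - w y)%C x (a - b)%C.
Proof.
  intros [Z1 Z2] [W1 W2]. split.
  - eapply derive_within_ext; [exact Dx| | |apply derive_within_plus;
      [exact Z1|apply (derive_within_scal D (- 1)); [exact Dx|exact W1]]].
    + intros y _. simpl. ring.
    + simpl. ring.
  - eapply derive_within_ext; [exact Dx| | |apply derive_within_plus;
      [exact Z2|apply (derive_within_scal D (- 1)); [exact Dx|exact W2]]].
    + intros y _. simpl. ring.
    + simpl. ring.
Qed.

Lemma Cderive_within_scal (z : R -> C) (a l : C) :
  Cderive_within D z x l -> Cderive_within D (fun y => a * z y)%C x (a * l)%C.
Proof.
  intros [Z1 Z2]. destruct a as [p q]. split.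
  - eapply derive_within_ext; [exact Dx| | |apply derive_within_plus;
      [apply (derive_within_scal D p); [exact Dx|exact Z1]
      |apply (derive_within_scal D (- q)); [exact Dx|exact Z2]]].
    + intros y _. simpl. ring.
    + simpl. ring.
  - eapply derive_within_ext; [exact Dx| | |apply derive_within_plus;
      [apply (derive_within_scal D p); [exact Dx|exact Z2]
      |apply (derive_within_scal D q); [exact Dx|exact Z1]]].
    + intros y _. simpl. ring.
    + simpl. ring.
Qed.

Lemma Cderive_within_csum (z : nat -> R -> C) (l : nat -> C) (N : nat) :
  (forall j, (1 <= j <= N)%nat -> Cderive_within D (z j) x (l j)) ->
  Cderive_within D (fun y => csum (fun j => z j y) N) x (csum l N).
Proof.
  intros H. split.
  - eapply derive_within_ext; [exact Dx| | |apply (derive_within_rsum D (fun j y => fst (z j y))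
      (fun j => fst (l j)) x N Dx); intros; apply H; assumption].
    + intros y _. symmetry. apply csum_fst.
    + symmetry. apply csum_fst.
  - eapply derive_within_ext; [exact Dx| | |apply (derive_within_rsum D (fun j y => snd (z j y))
      (fun j => snd (l j)) x N Dx); intros; apply H; assumption].
    + intros y _. symmetry. apply csum_snd.
    + symmetry. apply csum_snd.
Qed.

Lemma Cderive_within_ext (z w : R -> C) (l l' : C) :
  (forall y, D y -> z y = w y) -> l = l' ->
  Cderive_within D z x l -> Cderive_within D w x l'.
Proof.
  intros E <- [H1 H2]. split.
  - apply (derive_within_ext D x Dx (fun y => fst (z y)) _ (fst l)); [|reflexivity|exact H1].
    intros y Dy. now rewrite E.
  - apply (derive_within_ext D x Dx (fun y => snd (z y)) _ (snd l)); [|reflexivity|exact H2].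
    intros y Dy. now rewrite E.
Qed.

Lemma Cderive_within_dft (z : R -> nat -> C) (l : nat -> C) (N : nat) (k : Z) :
  (forall j, (1 <= j <= N)%nat -> Cderive_within D (fun y => z y j) x (l j)) ->
  Cderive_within D (fun y => dft N (z y) k) x (dft N l k).
Proof.
  intros H.
  apply (Cderive_within_ext (fun y => RtoC (/ INR N) * csum (fun j => expi (- (IZR k * grid N j)) * z y j) N)%C
    _ (RtoC (/ INR N) * csum (fun j => expi (- (IZR k * grid N j)) * l j) N)%C).
  - intros y _. rewrite dft_csum. f_equal. apply csum_ext. intros; ring.
  - rewrite dft_csum. f_equal. apply csum_ext. intros; ring.
  - apply Cderive_within_scal.
    apply (Cderive_within_csum (fun j y => expi (- (IZR k * grid N j)) * z y j)%C).
    intros j Hj. apply (Cderive_within_scal (fun y => z y j)), H, Hj.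
Qed.

Lemma derive_within_Cmod2 (z : R -> C) (l : C) :
  Cderive_within D z x l -> is_derive_within D (fun y => Cmod (z y) ^ 2) x (2 * inner (z x) l).
Proof.
  intros [Z1 Z2].
  eapply derive_within_ext; [exact Dx| | |apply derive_within_plus;
   [apply derive_within_mult; [exact Dx|exact Z1|exact Z1]|apply derive_within_mult; [exact Dx|exact Z2|exact Z2]]].
  - intros y _. rewrite Cmod2_inner. reflexivity.
  - unfold inner. ring.
Qed.

End CderiveWithin.

(** * The weighted energy and its growth *)

Section Energy.

Variables (T : R) (N : nat) (rho : R -> R) (c sigma w w' : nat -> R -> R)
  (p q tau : R -> nat -> C) (wmin W Cm d : R).
Let D (s : R) : Prop := 0 <= s <= T.
Hypothesis T_pos : 0 <= T.
Hypothesis N_pos : (0 < N)%nat.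
Hypothesis symbol_pos : forall i, (1 <= i <= N)%nat -> 0 <= symbol N rho i.
Hypothesis wmin_pos : 0 < wmin.
Hypothesis W_pos : 0 <= W.
Hypothesis Cm_pos : 0 <= Cm.
Hypothesis w_sigma : forall j t, (1 <= j <= N)%nat -> D t -> w j t * sigma j t = c j t.
Hypothesis w_min : forall j t, (1 <= j <= N)%nat -> D t -> wmin <= w j t.
Hypothesis c_bound : forall j t, (1 <= j <= N)%nat -> D t -> Rabs (c j t) <= Cm.
Hypothesis w'_bound : forall j t, (1 <= j <= N)%nat -> D t -> Rabs (w' j t) <= W.
Hypothesis tau_bound : forall j t, (1 <= j <= N)%nat -> D t -> Cmod (tau t j) <= d.
Hypothesis w_derive : forall j t, (1 <= j <= N)%nat -> D t -> is_derive_within D (w j) t (w' j t).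
Hypothesis p_derive : forall j t, (1 <= j <= N)%nat -> D t ->
  Cderive_within D (fun s => p s j) t
    (RtoC (sigma j t) * (filtered_Lambda N rho (q t) j + tau t j))%C.
Hypothesis q_derive : forall j t, (1 <= j <= N)%nat -> D t ->
  Cderive_within D (fun s => q s j) t (RtoC (- c j t) * p t j)%C.
Hypothesis p_init : forall j, (1 <= j <= N)%nat -> p 0 j = 0%C.
Hypothesis q_init : forall j, (1 <= j <= N)%nat -> q 0 j = 0%C.

Let h := mesh N.
Let h_pos : 0 < h. Proof. apply mesh_pos, N_pos. Qed.

Let Ep (t : R) : R := rsum (fun j => h * (w j t * Cmod (p t j) ^ 2)) N.
Let Eq (t : R) : R := rsum (fun j => h * Cmod (q t j) ^ 2) N.
Let EL (t : R) : R := rsum (fun i => symbol N rho i * Cmod (dft N (q t) (freq N i)) ^ 2) N.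
(** The factor 2 PI is the constant of [filtered_Lambda_duality]: with it, the last term is the form
    <q, L q> in the grid inner product. *)
Let E (t : R) : R := Ep t + Eq t + 2 * PI * EL t.

Let Ep' (t : R) : R := rsum (fun j => h * (w' j t * Cmod (p t j) ^ 2 + w j t *
  (2 * inner (p t j) (RtoC (sigma j t) * (filtered_Lambda N rho (q t) j + tau t j))%C))) N.
Let Eq' (t : R) : R := rsum (fun j => h * (2 * inner (q t j) (RtoC (- c j t) * p t j)%C)) N.
Let EL' (t : R) : R := rsum (fun i => symbol N rho i *
  (2 * inner (dft N (q t) (freq N i)) (dft N (fun j => RtoC (- c j t) * p t j)%C (freq N i)))) N.

Let E_derive (t : R) : D t -> is_derive_within D E t (Ep' t + Eq' t + 2 * PI * EL' t).
Proof.
  intros Dt. repeat apply derive_within_plus.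
  - apply (derive_within_rsum D (fun j s => h * (w j s * Cmod (p s j) ^ 2))); [exact Dt|].
    intros j Hj. apply derive_within_scal; [exact Dt|].
    apply derive_within_mult; [exact Dt|apply w_derive; assumption|].
    apply (derive_within_Cmod2 D t Dt (fun s => p s j)), p_derive; assumption.
  - apply (derive_within_rsum D (fun j s => h * Cmod (q s j) ^ 2)); [exact Dt|].
    intros j Hj. apply derive_within_scal; [exact Dt|].
    apply (derive_within_Cmod2 D t Dt (fun s => q s j)), q_derive; assumption.
  - apply derive_within_scal; [exact Dt|].
    apply (derive_within_rsum D (fun i s => symbol N rho i * Cmod (dft N (q s) (freq N i)) ^ 2)); [exact Dt|].
    intros i Hi. apply derive_within_scal; [exact Dt|].
    apply (derive_within_Cmod2 D t Dt (fun s => dft N (q s) (freq N i))).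
    apply (Cderive_within_dft D t Dt). intros j Hj. apply q_derive; assumption.
Qed.

Let P2 (t : R) : R := rsum (fun j => h * Cmod (p t j) ^ 2) N.

Let P2_pos (t : R) : 0 <= P2 t.
Proof.
  unfold P2. rewrite <- (Rmult_0_r (INR N)), <- rsum_const. apply rsum_le. intros j _.
  apply Rmult_le_pos; [lra|apply pow2_ge_0].
Qed.

Let Eq_pos (t : R) : 0 <= Eq t.
Proof.
  unfold Eq. rewrite <- (Rmult_0_r (INR N)), <- rsum_const. apply rsum_le. intros j _.
  apply Rmult_le_pos; [lra|apply pow2_ge_0].
Qed.

Let EL_pos (t : R) : 0 <= EL t.
Proof.
  unfold EL. rewrite <- (Rmult_0_r (INR N)), <- rsum_const. apply rsum_le. intros i Hi.
  apply Rmult_le_pos; [apply symbol_pos, Hi|apply pow2_ge_0].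
Qed.

Let P2_Ep (t : R) : D t -> wmin * P2 t <= Ep t.
Proof.
  intros Dt. unfold P2, Ep. rewrite <- rsum_scal. apply rsum_le. intros j Hj.
  generalize (w_min j t Hj Dt) (pow2_ge_0 (Cmod (p t j))). intros.
  replace (wmin * (h * Cmod (p t j) ^ 2)) with (h * (wmin * Cmod (p t j) ^ 2)) by ring.
  apply Rmult_le_compat_l; [lra|]. apply Rmult_le_compat_r; assumption.
Qed.

(* The terms containing [filtered_Lambda] in [Ep'] and [EL'] cancel by duality. *)
Let E'_split (t : R) : D t -> Ep' t + Eq' t + 2 * PI * EL' t
  = rsum (fun j => h * (w' j t * Cmod (p t j) ^ 2
      + 2 * (c j t * inner (p t j) (tau t j)) - 2 * (c j t * inner (q t j) (p t j)))) N.
Proof.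
  intros Dt.
  assert (H := filtered_Lambda_duality N rho (fun j => RtoC (- c j t) * p t j)%C (q t) N_pos).
  fold h in H.
  assert (H' : 2 * PI * EL' t = 2 * rsum (fun j => h * inner (RtoC (- c j t) * p t j)%C (filtered_Lambda N rho (q t) j)) N).
  { rewrite H. unfold EL'.
    rewrite (rsum_ext _ (fun i => 2 * (symbol N rho i * inner (dft N (fun j => RtoC (- c j t) * p t j)%C (freq N i))
        (dft N (q t) (freq N i))))) by (intros; unfold inner; ring).
    rewrite rsum_scal. ring. }
  rewrite H'. unfold Ep', Eq'. rewrite <- rsum_scal, <- !rsum_plus. apply rsum_ext. intros j Hj.
  (* Once c is written as w sigma, the cancellation takes place at each grid point, whatever the
     value of L q there. *)
  rewrite <- (w_sigma j t Hj Dt).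
  destruct (filtered_Lambda N rho (q t) j) as [l1 l2], (p t j) as [p1 p2], (q t j) as [q1 q2],
    (tau t j) as [t1 t2]. unfold inner. simpl. ring.
Qed.

(** [W] comes from the time derivative of the weight and 2 [Cm] from the two cross terms, all acting
    on |p|^2, which the energy controls up to 1 / [wmin]. The next [Cm] belongs to |q|^2, and 2 PI
    [Cm] to d^2, as the mesh widths add up to 2 PI. *)
Definition energy_rate : R := (W + 2 * Cm) / wmin + Cm + 2 * PI * Cm.

Let E_grow (t : R) : D t -> Ep' t + Eq' t + 2 * PI * EL' t <= energy_rate * (E t + d ^ 2).
Proof.
  intros Dt. rewrite E'_split by exact Dt.
  apply Rle_trans with ((W + 2 * Cm) * P2 t + Cm * Eq t + INR N * (h * (Cm * d ^ 2))).
  - unfold P2, Eq. rewrite <- !rsum_scal, <- rsum_const, <- !rsum_plus. apply rsum_le. intros j Hj.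
    replace ((W + 2 * Cm) * (h * Cmod (p t j) ^ 2) + Cm * (h * Cmod (q t j) ^ 2) + h * (Cm * d ^ 2))
      with (h * (W * Cmod (p t j) ^ 2 + Cm * (Cmod (p t j) ^ 2 + d ^ 2) + Cm * (Cmod (q t j) ^ 2 + Cmod (p t j) ^ 2))) by ring.
    apply Rmult_le_compat_l; [lra|].
    assert (H1 : w' j t * Cmod (p t j) ^ 2 <= W * Cmod (p t j) ^ 2).
    { apply Rmult_le_compat_r; [apply pow2_ge_0|].
      apply Rle_trans with (1 := Rle_abs _), w'_bound; assumption. }
    assert (Hc : forall x y, 2 * Rabs x <= y -> 2 * (c j t * x) <= Cm * y /\ - (2 * (c j t * x)) <= Cm * y).
    { intros x y Hxy.
      assert (Rabs (2 * (c j t * x)) <= Cm * y).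
      { rewrite !Rabs_mult, (Rabs_pos_eq 2) by lra.
        replace (2 * (Rabs (c j t) * Rabs x)) with (Rabs (c j t) * (2 * Rabs x)) by ring.
        apply Rmult_le_compat; [apply Rabs_pos| |apply c_bound; assumption|exact Hxy].
        generalize (Rabs_pos x). lra. }
      apply Rabs_le_between in H. lra. }
    destruct (Hc _ _ (inner_le (p t j) (tau t j))) as [H2 _].
    destruct (Hc _ _ (inner_le (q t j) (p t j))) as [_ H3].
    assert (Cmod (tau t j) ^ 2 <= d ^ 2).
    { apply pow_incr. split; [apply Cmod_ge_0|apply tau_bound; assumption]. }
    assert (Cm * (Cmod (p t j) ^ 2 + Cmod (tau t j) ^ 2) <= Cm * (Cmod (p t j) ^ 2 + d ^ 2))
      by (apply Rmult_le_compat_l; lra).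
    lra.
  - replace (INR N * (h * (Cm * d ^ 2))) with (INR N * h * (Cm * d ^ 2)) by ring.
    unfold h at 1. rewrite mesh_INR by exact N_pos.
    assert (H1 := P2_Ep t Dt). assert (H2 := P2_pos t). assert (H3 := Eq_pos t). assert (H4 := EL_pos t).
    assert (Ppos := PI_RGT_0). assert (d2 := pow2_ge_0 d).
    assert (H4' : 0 <= 2 * PI * EL t) by (apply Rmult_le_pos; lra).
    assert (H2' : 0 <= wmin * P2 t) by (apply Rmult_le_pos; lra).
    assert (H5 : P2 t <= E t / wmin).
    { apply Rmult_le_reg_r with wmin; [exact wmin_pos|].
      replace (E t / wmin * wmin) with (E t) by (field; lra). unfold E. lra. }
    assert (H6 : Eq t <= E t) by (unfold E; lra).
    assert (H7 : 0 <= E t) by lra.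
    assert (H8 : 0 <= (W + 2 * Cm) / wmin)
      by (apply Rmult_le_pos; [lra|apply Rlt_le, Rinv_0_lt_compat, wmin_pos]).
    apply Rle_trans with ((W + 2 * Cm) / wmin * E t + Cm * E t + 2 * PI * Cm * d ^ 2).
    + apply Rplus_le_compat; [apply Rplus_le_compat|].
      * replace ((W + 2 * Cm) / wmin * E t) with ((W + 2 * Cm) * (E t / wmin)) by (field; lra).
        apply Rmult_le_compat_l; lra.
      * apply Rmult_le_compat_l; lra.
      * apply Req_le. ring.
    + unfold energy_rate.
      assert (0 <= ((W + 2 * Cm) / wmin + Cm) * d ^ 2) by (apply Rmult_le_pos; lra).
      assert (0 <= 2 * PI * Cm * E t)
        by (apply Rmult_le_pos; [apply Rmult_le_pos|]; lra). lra.
Qed.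

Lemma energy_estimate (t : R) : 0 <= t <= T ->
  wmin * rsum (fun j => mesh N * Cmod (p t j) ^ 2) N <= d ^ 2 * exp (energy_rate * T) /\
  rsum (fun j => mesh N * Cmod (q t j) ^ 2) N
    + 2 * PI * rsum (fun i => symbol N rho i * Cmod (dft N (q t) (freq N i)) ^ 2) N
    <= d ^ 2 * exp (energy_rate * T).
Proof.
  intros Dt. fold h (P2 t) (Eq t) (EL t).
  assert (Ppos := PI_RGT_0).
  assert (H : E t <= d ^ 2 * exp (energy_rate * T)).
  { apply (gronwall_within T energy_rate (d ^ 2) E (fun s => Ep' s + Eq' s + 2 * PI * EL' s));
      [exact T_pos|apply pow2_ge_0| | |exact E_derive|exact E_grow|exact Dt].
    - unfold energy_rate. assert (H8 : 0 <= (W + 2 * Cm) / wmin)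
        by (apply Rmult_le_pos; [lra|apply Rlt_le, Rinv_0_lt_compat, wmin_pos]).
      assert (0 <= 2 * PI * Cm) by (apply Rmult_le_pos; lra). lra.
    - unfold E, Ep, Eq, EL.
      assert (Z : 0 = INR N * 0) by ring.
      rewrite (rsum_ext (fun j => h * (w j 0 * Cmod (p 0 j) ^ 2)) (fun _ => 0)).
      2: { intros j Hj. rewrite p_init, Cmod_0 by exact Hj. ring. }
      rewrite (rsum_ext (fun j => h * Cmod (q 0 j) ^ 2) (fun _ => 0)).
      2: { intros j Hj. rewrite q_init, Cmod_0 by exact Hj. ring. }
      rewrite (rsum_ext (fun i => symbol N rho i * Cmod (dft N (q 0) (freq N i)) ^ 2) (fun _ => 0)).
      2: { intros i Hi. rewrite dft_csum, (csum_ext _ (fun _ => 0 * 0)%C).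
           - rewrite csum_scal. replace (RtoC (/ INR N) * (0 * csum (fun _ => RtoC 0) N))%C with (RtoC 0) by ring.
             rewrite Cmod_0. ring.
           - intros j Hj. rewrite q_init by exact Hj. ring. }
      rewrite !rsum_const. ring. }
  assert (H1 := P2_Ep t Dt). assert (H2 := P2_pos t). assert (H3 := Eq_pos t). assert (H4 := EL_pos t).
  assert (H5 : 0 <= 2 * PI * EL t) by (apply Rmult_le_pos; lra).
  assert (H6 : 0 <= wmin * P2 t) by (apply Rmult_le_pos; lra).
  unfold E in H. split; lra.
Qed.

End Energy.

(** * Proof of the error bound *)

Lemma is_derive_fst (f : R -> C) (x : R) (l : C) :
  is_derive (V := C_R_NormedModule) f x l -> is_derive (fun y => fst (f y)) x (fst l).
Proof.
  intros Hf.
  apply (filterdiff_comp (F := locally x) f (fun z : C_R_NormedModule => fst z : R_NormedModule) _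
    (fun z : C_R_NormedModule => fst z : R_NormedModule) Hf).
  apply filterdiff_linear. apply (is_linear_fst (U := R_NormedModule) (V := R_NormedModule)).
Qed.

Lemma is_derive_snd (f : R -> C) (x : R) (l : C) :
  is_derive (V := C_R_NormedModule) f x l -> is_derive (fun y => snd (f y)) x (snd l).
Proof.
  intros Hf.
  apply (filterdiff_comp (F := locally x) f (fun z : C_R_NormedModule => snd z : R_NormedModule) _
    (fun z : C_R_NormedModule => snd z : R_NormedModule) Hf).
  apply filterdiff_linear. apply (is_linear_snd (U := R_NormedModule) (V := R_NormedModule)).
Qed.

Lemma reduce_to_period (p x : R) : 0 < p -> exists k y, 0 <= y <= p /\ x = y + IZR k * p.
Proof.
  intros Hp. exists (up (x / p) - 1)%Z, (x - IZR (up (x / p) - 1) * p).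
  destruct (archimed (x / p)) as [H1 H2]. rewrite minus_IZR.
  assert (E : x = x / p * p) by (field; lra).
  split; [|ring]. set (z := x / p) in *. rewrite E. split; nra.
Qed.

Lemma periodic_Z (V : Type) (f : R -> V) (p : R) :
  (forall x, f (x + p) = f x) -> forall k x, f (x + IZR k * p) = f x.
Proof.
  intros Hf.
  assert (H : forall n x, f (x + INR n * p) = f x).
  { induction n as [|n IH]; intros x; [simpl; now rewrite Rmult_0_l, Rplus_0_r|].
    rewrite S_INR. replace (x + (INR n + 1) * p) with (x + INR n * p + p) by ring.
    rewrite Hf. apply IH. }
  intros k x. destruct (Z_le_dec 0 k).
  - rewrite <- (Z2Nat.id k), <- INR_IZR_INZ by lia. apply H.
  - rewrite <- (H (Z.to_nat (- k)) (x + IZR k * p)). f_equal.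
    rewrite INR_IZR_INZ, Z2Nat.id, opp_IZR by lia. ring.
Qed.

(** What the weight c / sigma requires of the coefficients: it is differentiated once in time and
    evaluated at grid points, all of which lie in one closed period. *)
Lemma smooth_torus_time_derivative (T : R) (f : R -> R -> R) :
  0 <= T -> smooth_torus (V := R_NormedModule) T f ->
  exists f' K, 0 <= K /\
    (forall x t, 0 <= t <= T -> is_derive_within (fun s => 0 <= s <= T) (f x) t (f' x t)) /\
    (forall x t, 0 <= x <= 2 * PI -> 0 <= t <= T -> Rabs (f x t) <= K /\ Rabs (f' x t) <= K).
Proof.
  intros HT [_ [d [Hd0 Hd]]]. assert (Ppos := PI_RGT_0).
  destruct (strip_bounded T (2 * PI) (d 0%nat 0%nat) HT) as [K0 HK0]; [lra|apply Hd|].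
  destruct (strip_bounded T (2 * PI) (d 0%nat 1%nat) HT) as [K1 HK1]; [lra|apply Hd|].
  exists (d 0%nat 1%nat), (Rmax 0 (Rmax K0 K1)). split; [apply Rmax_l|]. split.
  - intros x t Ht.
    apply (derive_within_ext _ t Ht (d 0%nat 0%nat x) _ (d 0%nat 1%nat x t)); [|reflexivity|apply Hd, Ht].
    intros s Hs. apply Hd0, Hs.
  - intros x t Hx Ht. specialize (HK0 x t Hx Ht). specialize (HK1 x t Hx Ht).
    rewrite Hd0 in HK0 by exact Ht.
    generalize (Rmax_r 0 (Rmax K0 K1)) (Rmax_l K0 K1) (Rmax_r K0 K1). lra.
Qed.

(** For each t the derivatives in theta form a tower. Compactness bounds them over one period and
    all times, and periodicity extends the bounds to the line, so [B] does not depend on t. *)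
Lemma smooth_torus_tower (T : R) (f : R -> R -> C) :
  0 <= T -> smooth_torus (V := C_R_NormedModule) T f ->
  exists (B : nat -> R) (D : R -> nat -> R -> C), (forall a, B a <= B (S a)) /\
    forall t, 0 <= t <= T ->
      (forall x, D t 0%nat x = f x t) /\ Ctower (D t) /\
      (forall x, D t 0%nat (x + 2 * PI) = D t 0%nat x) /\ forall a x, Cmod (D t a x) <= B a.
Proof.
  intros HT [HP [d [Hd0 Hd]]]. assert (Ppos := PI_RGT_0).
  assert (Htower : forall t, 0 <= t <= T -> Ctower (fun a x => d a 0%nat x t)).
  { intros t Ht. split; intros a x; [apply (is_derive_fst (fun y => d a 0%nat y t))
      |apply (is_derive_snd (fun y => d a 0%nat y t))]; apply Hd, Ht. }
  assert (Hper : forall t, 0 <= t <= T -> forall a x, d a 0%nat (x + 2 * PI) t = d a 0%nat x t).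
  { intros t Ht a x. destruct (Htower t Ht) as [H1 H2].
    assert (E : forall y, d 0%nat 0%nat (y + 2 * PI) t = d 0%nat 0%nat y t)
      by (intros y; rewrite !Hd0 by exact Ht; apply HP, Ht).
    apply injective_projections.
    - apply (tower_periodic _ (2 * PI) H1). intros y. now rewrite E.
    - apply (tower_periodic _ (2 * PI) H2). intros y. now rewrite E. }
  assert (Hb : forall a, exists K, forall x t, 0 <= t <= T -> Cmod (d a 0%nat x t) <= K).
  { intros a.
    destruct (strip_bounded T (2 * PI) (fun x t => fst (d a 0%nat x t)) HT) as [K1 HK1]; [lra| |].
    { intros x t Ht P [e He].
      apply (proj2 (proj2 (Hd a 0%nat x t Ht)) (fun z => P (fst z))).
      exists e. intros z [Hz _]. apply He, Hz. }
    destruct (strip_bounded T (2 * PI) (fun x t => snd (d a 0%nat x t)) HT) as [K2 HK2]; [lra| |].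
    { intros x t Ht P [e He].
      apply (proj2 (proj2 (Hd a 0%nat x t Ht)) (fun z => P (snd z))).
      exists e. intros z [_ Hz]. apply He, Hz. }
    exists (K1 + K2). intros x t Ht.
    destruct (reduce_to_period (2 * PI) x) as [k [y [Hy ->]]]; [lra|].
    rewrite (periodic_Z _ (fun z => d a 0%nat z t) (2 * PI)) by (apply Hper, Ht).
    eapply Rle_trans; [apply Cmod_le_abs|].
    apply Rplus_le_compat; [apply HK1|apply HK2]; assumption. }
  set (B0 := fun a => proj1_sig (constructive_indefinite_description _ (Hb a))).
  assert (HB0 : forall a x t, 0 <= t <= T -> Cmod (d a 0%nat x t) <= B0 a)
    by (intros a; exact (proj2_sig (constructive_indefinite_description _ (Hb a)))).
  assert (B0pos : forall a, 0 <= B0 a).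
  { intros a. apply Rle_trans with (2 := HB0 a 0 0 ltac:(lra)), Cmod_ge_0. }
  (* Partial sums of the nonnegative bounds of orders 0 to a make the sequence monotone; [pred]
     compensates for sums starting at 1. *)
  exists (fun a => rsum (fun i => B0 (pred i)) (S a)), (fun t a x => d a 0%nat x t).
  split.
  - intros a. rewrite (rsum_S _ (S a)). simpl pred. generalize (B0pos (S a)). lra.
  - intros t Ht. split; [|split; [|split]].
    + intros x. apply Hd0, Ht.
    + apply Htower, Ht.
    + intros x. apply Hper, Ht.
    + intros a x. rewrite rsum_S. simpl pred. apply Rle_trans with (1 := HB0 a x t Ht).
      assert (0 <= rsum (fun i => B0 (pred i)) a); [|lra].
      rewrite <- (Rmult_0_r (INR a)), <- rsum_const. apply rsum_le. intros; apply B0pos.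
Qed.

Lemma Lambda_ext (f g : R -> C) (x : R) : (forall y, f y = g y) -> Lambda f x = Lambda g x.
Proof.
  intros E.
  assert (H : forall k, Lambda_mode f x k = Lambda_mode g x k).
  { intros k. unfold Lambda_mode, fourier. do 3 f_equal.
    apply RInt_ext. intros y _. now rewrite E. }
  unfold Lambda. f_equal; apply Series_ext; intros n; now rewrite !H.
Qed.

Lemma filtered_Lambda_ext (N : nat) (rho : R -> R) (f g : nat -> C) (j : nat) :
  (forall i, f i = g i) -> filtered_Lambda N rho f j = filtered_Lambda N rho g j.
Proof.
  intros E. rewrite !filtered_Lambda_csum. apply csum_ext. intros i _. do 2 f_equal.
  rewrite !dft_csum. f_equal. apply csum_ext. intros l _. now rewrite E.
Qed.

(** For N = 2 m the argument (i - m) h of the filter lies in the half-open interval on which [rho]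
    is nonnegative, with PI attained at i = N. *)
Lemma symbol_nonneg (r : nat) (rho : R -> R) (N i : nat) :
  filter_function r rho -> Nat.Even N -> (1 <= i <= N)%nat -> 0 <= symbol N rho i.
Proof.
  intros Hrho [m Hm] Hi. unfold symbol. apply Rmult_le_pos; [|apply IZR_le; lia].
  apply (filter_nonneg r rho Hrho). unfold filter_dom, freq.
  assert (HN : (0 < N)%nat) by lia. assert (hN := mesh_INR N HN). assert (hpos := mesh_pos N HN).
  replace (N / 2)%nat with m by (rewrite Hm, Nat.mul_comm, Nat.div_mul; lia).
  rewrite minus_IZR, <- !INR_IZR_INZ.
  assert (Hm' : INR N = 2 * INR m) by (rewrite Hm, mult_INR; reflexivity).
  assert (1 <= INR i) by (apply (le_INR 1); lia). assert (INR i <= INR N) by (apply le_INR; lia).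
  split; nra.
Qed.

Lemma grid_bounds (N j : nat) : (1 <= j <= N)%nat -> 0 <= grid N j <= 2 * PI.
Proof.
  intros Hj. assert (HN : (0 < N)%nat) by lia. unfold grid. rewrite <- (mesh_INR N HN).
  assert (hpos := mesh_pos N HN). split.
  - apply Rmult_le_pos; [apply pos_INR|lra].
  - apply Rmult_le_compat_r; [lra|]. apply le_INR. lia.
Qed.

Lemma sqrt_le_bound (x y : R) : 0 <= y -> x <= y ^ 2 -> sqrt x <= y.
Proof.
  intros Hy Hx. rewrite <- (sqrt_pow2 y Hy). apply sqrt_le_1_alt, Hx.
Qed.

Theorem proposition2
    (T : R) (sigma c g1 g2 : R -> R -> R) (sigma0 c0 : R)
    (r : nat) (rho : R -> R) (u v : R -> R -> C)
    (T_pos : 0 < T)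
    (sigma_smooth : smooth_torus (V := R_NormedModule) T sigma)
    (c_smooth : smooth_torus (V := R_NormedModule) T c)
    (g1_smooth : smooth_torus (V := R_NormedModule) T g1)
    (g2_smooth : smooth_torus (V := R_NormedModule) T g2)
    (sigma0_pos : 0 < sigma0)
    (sigma_lower : forall theta t, 0 <= t <= T -> sigma0 <= sigma theta t)
    (c0_pos : 0 < c0)
    (c_lower : forall theta t, 0 <= t <= T -> c0 <= c theta t)
    (r_pos : (0 < r)%nat)
    (rho_filter : filter_function r rho)
    (u_smooth : smooth_torus (V := C_R_NormedModule) T u)
    (v_smooth : smooth_torus (V := C_R_NormedModule) T v)
    (uv_exact : exact_solution T sigma c g1 g2 u v) :
  exists M : R, 0 < M /\
    forall N : nat, (0 < N)%nat -> Nat.Even N ->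
    forall Uh Vh : R -> nat -> C,
      semidiscrete_solution T sigma c g1 g2 rho N Uh Vh ->
      (forall j, (1 <= j <= N)%nat ->
         Uh 0 j = restrict N u 0 j /\ Vh 0 j = restrict N v 0 j) ->
      forall t, 0 <= t <= T ->
        norm_l2 N (fun j => Uh t j - restrict N u t j)%C <= M * mesh N ^ r /\
        norm_Hhalf N rho (fun j => Vh t j - restrict N v t j)%C <= M * mesh N ^ r.
Proof.
  assert (HT : 0 <= T) by lra.
  destruct (smooth_torus_time_derivative T sigma HT sigma_smooth) as [sigma' [S [HS [Dsigma Bsigma]]]].
  destruct (smooth_torus_time_derivative T c HT c_smooth) as [c' [Cm [HCm [Dc Bc]]]].
  destruct (smooth_torus_tower T v HT v_smooth) as [B [D [HM HD]]].
  destruct (filtered_Lambda_consistent r rho B rho_filter HM) as [A [HA Hcons]].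
  (* A lower bound for c / sigma, since sigma <= [S]; adding [sigma0] makes the denominator visibly
     positive. *)
  set (wmin := c0 / (S + sigma0)). assert (Hwmin : 0 < wmin) by (apply Rdiv_lt_0_compat; lra).
  (* The quotient rule for c / sigma, with |c| and |c'| at most [Cm], |sigma'| at most [S] and sigma
     at least [sigma0]. *)
  set (W := Cm / sigma0 + Cm * S / sigma0 ^ 2).
  assert (HW : 0 <= W).
  { assert (0 < sigma0 ^ 2) by (apply pow_lt; lra).
    apply Rplus_le_le_0_compat; apply Rmult_le_pos; try nra; apply Rlt_le, Rinv_0_lt_compat; lra. }
  set (X := exp (energy_rate wmin W Cm * T)). assert (HX : 0 < X) by apply exp_pos.
  (* One constant for both squared norms: [X] / [wmin] serves p and [X] serves q. *)
  set (Q := X * (/ wmin + 1)).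
  assert (HwI : 0 < / wmin) by (apply Rinv_0_lt_compat, Hwmin).
  assert (HQ : 0 < Q) by (apply Rmult_lt_0_compat; lra).
  (* A + 1 keeps the constant positive when A = 0, and Q <= (Q + 1)^2 avoids a square root of
     [Q]. *)
  exists ((A + 1) * (Q + 1)). split; [apply Rmult_lt_0_compat; lra|].
  intros N HN Neven Uh Vh Hsd Hinit.
  set (p := fun t j => (Uh t j - restrict N u t j)%C).
  set (q := fun t j => (Vh t j - restrict N v t j)%C).
  set (tau := fun t j => (filtered_Lambda N rho (restrict N v t) j - Lambda (fun x => v x t) (grid N j))%C).
  set (h := mesh N). assert (hpos : 0 < h) by apply (mesh_pos N HN).
  assert (Hr : 0 < h ^ r) by (apply pow_lt, hpos).
  set (I := fun s => 0 <= s <= T).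
  assert (Htau : forall j t, (1 <= j <= N)%nat -> I t -> Cmod (tau t j) <= A * h ^ r).
  { intros j t Hj Ht. destruct (HD t Ht) as [E0 [E1 [E2 E3]]].
    unfold tau.
    rewrite (filtered_Lambda_ext N rho _ (fun i => D t 0%nat (grid N i)))
      by (intros i; symmetry; apply E0).
    rewrite (Lambda_ext _ (D t 0%nat)) by (intros y; symmetry; apply E0).
    apply Hcons; assumption. }
  assert (Hsym : forall i, (1 <= i <= N)%nat -> 0 <= symbol N rho i)
    by (intros i Hi; apply (symbol_nonneg r); assumption).
  set (w := fun j s => c (grid N j) s * / sigma (grid N j) s).
  set (w' := fun j s => c' (grid N j) s * / sigma (grid N j) s
     + c (grid N j) s * (sigma' (grid N j) s * - / sigma (grid N j) s ^ 2)).
  assert (Hest := energy_estimate T N rho (fun j s => c (grid N j) s) (fun j s => sigma (grid N j) s) w w'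
    p q tau wmin W Cm (A * h ^ r) HT HN Hsym Hwmin HW HCm).
  assert (H : forall t, 0 <= t <= T ->
    wmin * rsum (fun j => h * Cmod (p t j) ^ 2) N <= (A * h ^ r) ^ 2 * X /\
    rsum (fun j => h * Cmod (q t j) ^ 2) N
      + 2 * PI * rsum (fun i => symbol N rho i * Cmod (dft N (q t) (freq N i)) ^ 2) N
      <= (A * h ^ r) ^ 2 * X).
  { apply Hest; clear Hest; try exact Htau.
    - intros j t Hj Ht. unfold w. specialize (sigma_lower (grid N j) t Ht). field. lra.
    - intros j t Hj Ht. unfold w, wmin.
      specialize (sigma_lower (grid N j) t Ht). specialize (c_lower (grid N j) t Ht).
      destruct (Bsigma (grid N j) t (grid_bounds N j Hj) Ht) as [Bs _].
      assert (sigma (grid N j) t <= S) by (apply Rle_trans with (1 := Rle_abs _), Bs).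
      apply Rmult_le_compat; [lra|apply Rlt_le, Rinv_0_lt_compat; lra|exact c_lower|].
      apply Rinv_le_contravar; lra.
    - intros j t Hj Ht. apply (Bc (grid N j) t (grid_bounds N j Hj) Ht).
    - intros j t Hj Ht. unfold w', W.
      specialize (sigma_lower (grid N j) t Ht).
      destruct (Bsigma (grid N j) t (grid_bounds N j Hj) Ht) as [_ Bs].
      destruct (Bc (grid N j) t (grid_bounds N j Hj) Ht) as [Bc0 Bc1].
      set (s := sigma (grid N j) t) in *.
      assert (0 < s ^ 2) by (apply pow_lt; lra).
      assert (P1 : / s <= / sigma0) by (apply Rinv_le_contravar; lra).
      assert (P2 : / s ^ 2 <= / sigma0 ^ 2) by (apply Rinv_le_contravar; [apply pow_lt; lra|apply pow_incr; lra]).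
      assert (0 < / s) by (apply Rinv_0_lt_compat; lra).
      assert (0 < / s ^ 2) by (apply Rinv_0_lt_compat; lra).
      eapply Rle_trans; [apply Rabs_triang|].
      rewrite !Rabs_mult, Rabs_Ropp, (Rabs_pos_eq (/ s)), (Rabs_pos_eq (/ s ^ 2)) by lra.
      apply Rplus_le_compat.
      + apply Rmult_le_compat; [apply Rabs_pos|lra|exact Bc1|exact P1].
      + unfold Rdiv. rewrite Rmult_assoc.
        apply Rmult_le_compat; [apply Rabs_pos| |exact Bc0|].
        * apply Rmult_le_pos; [apply Rabs_pos|lra].
        * apply Rmult_le_compat; [apply Rabs_pos|lra|exact Bs|exact P2].
    - intros j t Hj Ht. unfold w, w'.
      specialize (sigma_lower (grid N j) t Ht).
      apply (derive_within_mult I t Ht (c (grid N j)) (fun s => / sigma (grid N j) s)); [apply Dc, Ht|].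
      apply (derive_within_comp I t Ht (sigma (grid N j)) Rinv); [apply Dsigma, Ht|].
      evar_last; [apply (is_derive_inv (fun y => y)); [apply (is_derive_id (K := R_AbsRing))|lra]|].
      unfold one; simpl. field. lra.
    - intros j t Hj Ht. destruct (Hsd t j Ht Hj) as [HU _]. destruct (uv_exact (grid N j) t Ht) as [Hu _].
      eapply (Cderive_within_ext I t Ht); [intros; reflexivity| |apply (Cderive_within_minus I t Ht)].
      3: { split; [apply (derive_within_fst I t _ _ Hu)|apply (derive_within_snd I t _ _ Hu)]. }
      2: { split; [apply (derive_within_fst I t _ _ HU)|apply (derive_within_snd I t _ _ HU)]. }
      (* Linearity of L turns the difference of L V_h and the exact Lambda v into L q + tau; the
         source terms [g1] cancel. *)
      unfold q, tau. rewrite filtered_Lambda_minus. ring.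
    - intros j t Hj Ht. destruct (Hsd t j Ht Hj) as [_ HU]. destruct (uv_exact (grid N j) t Ht) as [_ Hu].
      eapply (Cderive_within_ext I t Ht); [intros; reflexivity| |apply (Cderive_within_minus I t Ht)].
      3: { split; [apply (derive_within_fst I t _ _ Hu)|apply (derive_within_snd I t _ _ Hu)]. }
      2: { split; [apply (derive_within_fst I t _ _ HU)|apply (derive_within_snd I t _ _ HU)]. }
      unfold p, restrict. rewrite RtoC_opp. ring.
    - intros j Hj. destruct (Hinit j Hj) as [E _]. unfold p. rewrite E. ring.
    - intros j Hj. destruct (Hinit j Hj) as [_ E]. unfold q. rewrite E. ring. }
  intros t Ht. destruct (H t Ht) as [H1 H2].
  assert (Hbound : forall z, z <= (A * h ^ r) ^ 2 * Q -> sqrt z <= (A + 1) * (Q + 1) * h ^ r).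
  { intros z Hz. apply sqrt_le_bound; [repeat apply Rmult_le_pos; lra|].
    apply Rle_trans with (1 := Hz).
    replace (((A + 1) * (Q + 1) * h ^ r) ^ 2) with (((A + 1) * h ^ r) ^ 2 * (Q + 1) ^ 2) by ring.
    apply Rmult_le_compat; [apply pow2_ge_0|lra| |nra].
    apply pow_incr. split; [apply Rmult_le_pos; lra|]. apply Rmult_le_compat_r; lra. }
  assert (HXA : 0 <= (A * h ^ r) ^ 2 * X) by (apply Rmult_le_pos; [apply pow2_ge_0|lra]).
  assert (HQe : (A * h ^ r) ^ 2 * Q = (A * h ^ r) ^ 2 * X * / wmin + (A * h ^ r) ^ 2 * X) by (unfold Q; ring).
  assert (HXw : 0 <= (A * h ^ r) ^ 2 * X * / wmin) by (apply Rmult_le_pos; lra).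
  split.
  - apply Hbound. change (rsum (fun j => h * Cmod (p t j) ^ 2) N <= (A * h ^ r) ^ 2 * Q).
    apply Rle_trans with ((A * h ^ r) ^ 2 * X * / wmin); [|lra].
    apply Rmult_le_reg_l with wmin; [exact Hwmin|].
    replace (wmin * ((A * h ^ r) ^ 2 * X * / wmin)) with ((A * h ^ r) ^ 2 * X) by (field; lra).
    exact H1.
  - apply Hbound.
    change (rsum (fun i => (1 + IZR (Z.abs (freq N i)) * rho (IZR (freq N i) * h)) *
       Cmod (dft N (q t) (freq N i)) ^ 2) N <= (A * h ^ r) ^ 2 * Q).
    rewrite (rsum_ext _ (fun i => Cmod (dft N (q t) (freq N i)) ^ 2
      + symbol N rho i * Cmod (dft N (q t) (freq N i)) ^ 2)).
    2: { intros i _. unfold symbol. fold h. rewrite (Rmult_comm h). ring. }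
    rewrite rsum_plus, dft_parseval by exact HN.
    set (Y := rsum (fun i => symbol N rho i * Cmod (dft N (q t) (freq N i)) ^ 2) N) in *.
    rewrite rsum_scal in H2. set (Z := rsum (fun j => Cmod (q t j) ^ 2) N) in *.
    assert (HNh := mesh_INR N HN). fold h in HNh. assert (Npos := lt_0_INR _ HN).
    (* By Parseval, 2 PI times the squared H^{1/2} norm is exactly the part of the energy that
       belongs to q; since 2 PI >= 1, the bound on the latter carries over. *)
    assert (E : 2 * PI * (/ INR N * Z + Y) = h * Z + 2 * PI * Y).
    { rewrite <- HNh. field. lra. }
    rewrite <- E in H2.
    assert (P2 := PI2_1).
    assert (0 <= Y).
    { unfold Y. rewrite <- (Rmult_0_r (INR N)), <- rsum_const. apply rsum_le. intros i Hi.
      apply Rmult_le_pos; [apply Hsym, Hi|apply pow2_ge_0]. }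
    assert (0 <= / INR N * Z).
    { apply Rmult_le_pos; [apply Rlt_le, Rinv_0_lt_compat, Npos|].
      unfold Z. rewrite <- (Rmult_0_r (INR N)), <- rsum_const. apply rsum_le. intros j _. apply pow2_ge_0. }
    assert (/ INR N * Z + Y <= 2 * PI * (/ INR N * Z + Y)) by nra.
    lra.
Qed.
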